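(* Let $n\geq 1$ be an integer and let $\ell$ be a real number with $\ell>\frac n4-\frac12$ if $n\geq 6$, and $\ell\geq 1$ if $1\leq n\leq 5$. There exist constants $C>0$, $\alpha>0$ and $T>0$ (independent of the initial data) such that for every $[u_0,u_1]\in (H^{\ell}(\mathbf{R}^n)\cap L^{1,1}(\mathbf{R}^n))\times(H^{\ell-1}(\mathbf{R}^n)\cap L^{1,1}(\mathbf{R}^n))$, the solution $u$ of the Cauchy problem $$u_{tt}-\Delta u+(-\Delta)^{2}u_t=0 \ \text{ in } (0,\infty)\times\mathbf{R}^n,\qquad u(0,x)=u_0(x),\quad u_t(0,x)=u_1(x),$$ satisfies, for all $t\geq T$, $$\int_{\mathbf{R}^n}\left|\hat u(t,\xi)-\left\{P_1e^{-t|\xi|^4/2}\frac{\sin(t|\xi|)}{|\xi|}+P_0e^{-t|\xi|^4/2}\cos(t|\xi|)\right\}\right|^2d\xi$$ $$\leq C\Vert u_1\Vert_{1,1}^2t^{-\frac n4}+C\Vert u_0\Vert_{1,1}^2t^{-\frac{n+2}4}+Ce^{-\alpha t}\left(\Vert u_1\Vert_1^2+\Vert u_0\Vert_1^2+\Vert u_1\Vert^2+\Vert u_0\Vert^2\right)+Ct^{-\ell}\left(\Vert D^{\ell-1}u_1\Vert^2+\Vert D^{\ell}u_0\Vert^2\right).$$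
   Context: $\Vert\cdot\Vert_q$ is the norm of $L^q(\mathbf{R}^n)$ and $\Vert\cdot\Vert=\Vert\cdot\Vert_2$. $L^{1,1}(\mathbf{R}^n)$ is the space of $f\in L^1(\mathbf{R}^n)$ with $\Vert f\Vert_{1,1}:=\int_{\mathbf{R}^n}(1+|x|)|f(x)|\,dx<\infty$. The Fourier transform is $\hat f(\xi)=\int_{\mathbf{R}^n}e^{-ix\cdot\xi}f(x)\,dx$ (extended to $L^2$); $\hat u(t,\xi)$ is the Fourier transform of $u(t,\cdot)$. For $s\ge 0$ and $f\in H^{s}(\mathbf{R}^n)$, $\Vert D^{s}f\Vert:=\left(\int_{\mathbf{R}^n}|\xi|^{2s}|\hat f(\xi)|^2d\xi\right)^{1/2}$. Moreover $P_j:=\int_{\mathbf{R}^n}u_j(x)\,dx$ for $j=0,1$. Solution means the unique mild solution $u\in C([0,\infty);H^1(\mathbf{R}^n))\cap C^1([0,\infty);L^2(\mathbf{R}^n))$; its Fourier transform in $x$ solves, for a.e. $\xi\in\mathbf{R}^n$, the ODE $\hat u_{tt}(t,\xi)+|\xi|^2\hat u(t,\xi)+|\xi|^{4}\hat u_t(t,\xi)=0$ for $t>0$, with $\hat u(0,\xi)=\hat u_0(\xi)$, $\hat u_t(0,\xi)=\hat u_1(\xi)$. *)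

(* Defs.v *)
From HB Require Import structures.
From mathcomp Require Import all_boot all_order all_algebra.
From mathcomp Require Import all_classical all_reals all_analysis.
From mathcomp Require Import complex.
Set Implicit Arguments.
Unset Strict Implicit.
Unset Printing Implicit Defensive.
Import Order.TTheory GRing.Theory Num.Theory.
Import numFieldNormedType.Exports.
Local Open Scope classical_set_scope.
Local Open Scope ring_scope.

Notation Rn R n := (n.-tuple (measurableTypeR R))%type.

Section consRn.
Context {R : realType} {n : nat}.

Definition consRn (p : measurableTypeR R * Rn R n) : Rn R n.+1 :=
  [tuple of p.1 :: p.2].

Definition unconsRn (v : Rn R n.+1) : measurableTypeR R * Rn R n :=
  (tnth v ord0, [tuple of behead v]).

Lemma measurable_consRn : measurable_fun setT consRn.
Proof. exact: measurable_cons. Qed.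

Lemma measurable_unconsRn : measurable_fun setT unconsRn.
Proof.
apply: measurable_fun_pair; first exact: measurable_tnth.
exact: measurable_behead.
Qed.

Lemma consRnK : cancel consRn unconsRn.
Proof.
by move=> -[x v]; rewrite /unconsRn/=; congr pair; apply/val_inj.
Qed.

Lemma unconsRnK : cancel unconsRn consRn.
Proof. by move=> v; rewrite [RHS]tuple_eta; apply/val_inj. Qed.

End consRn.

Section lebesgue_cons.
Context {R : realType} {n : nat}.
Variable m : {sigma_finite_measure set (Rn R n) -> \bar R}.

Definition lebesgue_cons : set (Rn R n.+1) -> \bar R :=
  pushforward ((@lebesgue_measure R) \x m)%E consRn.

Let lebesgue_cons0 : lebesgue_cons set0 = 0%E.
Proof. by rewrite /lebesgue_cons /pushforward preimage_set0 measure0. Qed.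

Let lebesgue_cons_ge0 A : (0 <= lebesgue_cons A)%E.
Proof. by apply: measure_ge0 => //; exact: measurable_consRn. Qed.

Let lebesgue_cons_sigma_additive : semi_sigma_additive lebesgue_cons.
Proof.
by apply: measure_semi_sigma_additive => //; exact: measurable_consRn.
Qed.

HB.instance Definition _ := isMeasure.Build _ _ _ lebesgue_cons
  lebesgue_cons0 lebesgue_cons_ge0 lebesgue_cons_sigma_additive.

Let lebesgue_cons_sigma_finite : sigma_finite setT lebesgue_cons.
Proof.
have /sigma_finiteP[F [TF ndF Foo]] := sigma_finiteT (@lebesgue_measure R).
have /sigma_finiteP[G [TG ndG Goo]] := sigma_finiteT m.
exists (fun k => unconsRn @^-1` (F k `*` G k)).
  rewrite -preimage_bigcup [X in _ @^-1` X](_ : _ = setT) ?preimage_setT//.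
  apply/seteqP; split => // -[x y] _.
  have [i _ Fix] : (\bigcup_i F i) x by rewrite -TF.
  have [j _ Gjy] : (\bigcup_i G i) y by rewrite -TG.
  exists (maxn i j) => //; split => /=.
    by move: x Fix; exact/subsetPset/ndF/leq_maxl.
  by move: y Gjy; exact/subsetPset/ndG/leq_maxr.
move=> k; have [mF Fk] := Foo k; have [mG Gk] := Goo k; split.
  rewrite -[X in measurable X]setTI.
  by apply: measurable_unconsRn => //; exact: measurableX.
rewrite /lebesgue_cons /pushforward -comp_preimage.
have -> : unconsRn \o consRn = @id (measurableTypeR R * Rn R n).
  exact/funext/consRnK.
by rewrite product_measure1E// lte_mul_pinfty// ge0_fin_numE.
Qed.

HB.instance Definition _ := Measure_isSigmaFinite.Build _ _ _ lebesgue_cons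
  lebesgue_cons_sigma_finite.

End lebesgue_cons.

Fixpoint lebesgue_Rn_rec (R : realType) (n : nat) :
    {sigma_finite_measure set (Rn R n) -> \bar R} :=
  if n is k.+1 then lebesgue_cons (lebesgue_Rn_rec R k)
  else \d_([tuple] : Rn R 0).

Definition lebesgue_Rn (R : realType) (n : nat) : set (Rn R n) -> \bar R :=
  lebesgue_Rn_rec R n.

HB.instance Definition _ R n :=
  SigmaFiniteMeasure.copy (@lebesgue_Rn R n) (lebesgue_Rn_rec R n).

Section function_spaces.
Context {R : realType} {n : nat}.
Local Notation mu := (@lebesgue_Rn R n).
Implicit Types (f g : Rn R n -> R[i]) (x xi : Rn R n) (s : R).

Definition dotRn x y : R := \sum_(i < n) (tnth x i : R) * (tnth y i : R).

Definition normRn x : R := Num.sqrt (dotRn x x).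

Definition cintegral f : R[i] :=
  Complex (\int[mu]_x complex.Re (f x)) (\int[mu]_x complex.Im (f x)).

Definition cLnorm (p : \bar R) f : \bar R :=
  'N[mu]_p[EFin \o (@Normc.normc R \o f)]%E.

(* Borel measurability loses no class of functions: a Lebesgue measurable
   function agrees with a Borel one outside a null set. *)
Definition cLfun (p : \bar R) f : Prop :=
  [/\ measurable_fun setT (fun x => complex.Re (f x)),
      measurable_fun setT (fun x => complex.Im (f x)) &
      (cLnorm p f < +oo)%E].

Definition L11norm f : \bar R :=
  (\int[mu]_x ((1 + normRn x) * Normc.normc (f x))%:E)%E.

Definition L11 f : Prop := cLfun 1%E f /\ (L11norm f < +oo)%E.

Definition fourier_integral f xi : R[i] :=
  cintegral (fun x => Complex (cos (dotRn x xi)) (- sin (dotRn x xi)) * f x).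

(* [g] is a limit in L^2 of the transforms of functions of L^1 and L^2 that
   tend to [f] in L^2; by Plancherel's theorem every [f] in L^2 has such a [g],
   unique up to a null set. *)
Definition fourier_L2_limit f g : Prop :=
  cLfun 2%:E g /\
  exists f_ : nat -> Rn R n -> R[i],
    [/\ forall k, cLfun 1%E (f_ k) /\ cLfun 2%:E (f_ k),
        cLnorm 2%:E (f_ k \- f) @[k --> \oo] --> 0%E &
        cLnorm 2%:E (fourier_integral (f_ k) \- g) @[k --> \oo] --> 0%E].

(* The integral on L^1, a choice of representative of the L^2 extension on
   the rest of L^2, and a meaningless value elsewhere. *)
Definition fourier f : Rn R n -> R[i] :=
  if `[< cLfun 1%E f >] then fourier_integral f
  else xget (fun=> 0) [set g | fourier_L2_limit f g].

Definition Hnorm s f : \bar R :=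
  ((\int[mu]_xi ((1 + normRn xi ^+ 2) `^ s
                 * Normc.normc (fourier f xi) ^+ 2)%:E) `^ 2^-1)%E.

Definition Hs s f : Prop := cLfun 2%:E f /\ (Hnorm s f < +oo)%E.

Definition Dnorm s f : \bar R :=
  ((\int[mu]_xi (normRn xi `^ (2 * s)
                 * Normc.normc (fourier f xi) ^+ 2)%:E) `^ 2^-1)%E.

End function_spaces.

(* Derivative within [0, +oo[, hence one-sided at 0. *)
Definition is_derive_nonneg (R : realType) (y : R -> R[i]) (t : R) (dy : R[i])
    : Prop :=
  Normc.normc (real_complex R (s - t)^-1 * (y s - y t) - dy)
    @[s --> within `[0, +oo[ t^'] --> (0 : R).

(* y'' + r^2 y + r^4 y' = 0 for t > 0, y(0) = a, y'(0) = b *)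
Definition fourier_ode (R : realType) (r : R) (a b : R[i]) (y : R -> R[i])
    : Prop :=
  exists dy : R -> R[i],
    [/\ forall t : R, 0 <= t -> is_derive_nonneg y t (dy t),
        y 0 = a, dy 0 = b &
        forall t : R, 0 < t -> exists2 ddy : R[i], is_derive_nonneg dy t ddy &
          ddy + real_complex R (r ^+ 2) * y t
              + real_complex R (r ^+ 4) * dy t = 0].

(* Only the values [u t] for [0 <= t] matter.  Since each Fourier transform is
   defined up to a null set that depends on [t], the ordinary differential
   equation in [t] is required of some choice [w t] of representatives. *)
Record mild_solution (R : realType) (n : nat) (u0 u1 : Rn R n -> R[i])
    (u : R -> Rn R n -> R[i]) : Prop := MildSolution {
  mild_H1 : forall t : R, 0 <= t -> Hs 1 (u t) ;
  mild_continuous : forall t : R, 0 <= t ->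
    Hnorm 1 (u s \- u t) @[s --> within `[0, +oo[ t^'] --> 0%E ;
  mild_C1 : exists v : R -> Rn R n -> R[i],
    [/\ forall t : R, 0 <= t -> cLfun 2%:E (v t),
        forall t : R, 0 <= t ->
          cLnorm 2%:E (v s \- v t) @[s --> within `[0, +oo[ t^'] --> 0%E,
        forall t : R, 0 <= t ->
          cLnorm 2%:E
            (fun x => real_complex R (s - t)^-1 * (u s x - u t x) - v t x)
            @[s --> within `[0, +oo[ t^'] --> 0%E &
        {ae @lebesgue_Rn R n, forall x, u 0 x = u0 x /\ v 0 x = u1 x}] ;
  mild_fourier : exists w : R -> Rn R n -> R[i],
    (forall t : R, 0 <= t ->
       {ae @lebesgue_Rn R n, forall xi, w t xi = fourier (u t) xi}) /\
    {ae @lebesgue_Rn R n, forall xi,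
       fourier_ode (normRn xi) (fourier u0 xi) (fourier u1 xi) (w ^~ xi)} }.

(* Main.v *)
Require Import Defs.
From HB Require Import structures.
From mathcomp Require Import all_boot all_order all_algebra.
From mathcomp Require Import all_classical all_reals all_analysis.
From mathcomp Require Import measurable_realfun complex.
From mathcomp Require Import ring lra.
Set Implicit Arguments.
Unset Strict Implicit.
Unset Printing Implicit Defensive.
Import Order.TTheory GRing.Theory Num.Theory.
Import numFieldNormedType.Exports.
Local Open Scope classical_set_scope.
Local Open Scope ring_scope.

(* Split the solution of the frequency-wise oscillator
   y'' + r^2 y + r^4 y' = 0, with r = |xi|, at r = 1.

   The Lyapunov function Q = (y' + r^4 y / 2)^2 + (r^2 + r^8 / 4) y^2 satisfies
   Q' = - r^4 y'^2 - r^6 y^2 <= - r^4 / (2 + r^6) Q.  For r >= 1 this rate is at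
   least 1 / (3 r^2), and e^{- t / (3 r^2)} <= (3 l r^2 / t)^l trades decay in
   time for derivatives of the data, while the profile itself is exponentially
   small.  The same decay estimate, applied to a difference, gives uniqueness;
   so for r <= 1 the solution is the explicit one, of frequency
   w = r (1 - r^6 / 4)^{1/2}, and |r - w| <= r^7 / 4 together with
   |hat u_j - P_j| <= 2 r ||u_j||_{1,1} and |sin (t r) / r| <= 1 / r bounds the
   error by e^{- t r^4 / 2} (2 + t r^4) (r ||u_0||_{1,1} + ||u_1||_{1,1}) up to a
   constant.  Since t r^4 / 2 >= t^{1/2} r^2 - 1 / 2, what remains is a Gaussian
   integral over R^n, which factors over the coordinates. *)

(** * The damped oscillator *)

(** The initial velocity enters as a right difference quotient at 0: a two-sided derivative there
    would constrain the values at negative times. *)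
Definition damped_osc (R : realType) (r a b : R) (y dy : R -> R) : Prop :=
  [/\ y 0 = a, (y s - a) / s @[s --> 0^'+] --> b,
      forall t : R, 0 < t -> is_derive t 1 y (dy t) &
      forall t : R, 0 < t ->
        is_derive t 1 dy (- (r ^+ 2 * y t) - r ^+ 4 * dy t)].

Section damped_oscillator.
Context {R : realType}.
Implicit Types (r a b t : R) (y dy z dz : R -> R).

Lemma is_derive1D (f g : R -> R) (t df dg : R) : is_derive t 1 f df ->
  is_derive t 1 g dg -> is_derive t 1 (fun x => f x + g x) (df + dg).
Proof. exact: is_deriveD. Qed.

Lemma is_derive1M (f g : R -> R) (t df dg : R) : is_derive t 1 f df ->
  is_derive t 1 g dg -> is_derive t 1 (fun x => f x * g x) (f t * dg + g t * df).
Proof. exact: is_deriveM. Qed.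

Lemma is_derive1Z (c : R) (f : R -> R) (t df : R) : is_derive t 1 f df ->
  is_derive t 1 (fun x => c * f x) (c * df).
Proof. exact: is_deriveZ. Qed.

Lemma is_derive1_dilate (F : R -> R) (c t dF : R) : is_derive (c * t) 1 F dF ->
  is_derive t 1 (fun x => F (c * x)) (c * dF).
Proof.
move=> dF'; rewrite mulrC.
have dc : is_derive t 1 (fun x : R => c * x) c.
  by apply: is_derive_eq (is_derive1Z c (is_derive_id t 1)) _; rewrite mulr1.
exact: (@is_derive1_comp _ F (fun x => c * x) t dF c).
Qed.

(* [dy] is not assumed right continuous at 0, hence the mean value theorem. *)
Lemma damped_osc_near0 r a b y dy t e : damped_osc r a b y dy ->
  0 < t -> 0 < e ->
  exists2 s, 0 < s < t & `|y s - a| < e /\ `|dy s - b| < e.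
Proof.
move=> [y0 dy0 yE _] t0 e0.
(* Right continuity at 0, from y(s) = ((y(s) - a) / s) s + a. *)
have ycvg : y s @[s --> 0^'+] --> a.
  have H : (y s - a) / s * s + a @[s --> 0^'+] --> b * 0 + a.
    apply: cvgD; last exact: cvg_cst.
    by apply: cvgM => //; apply: cvg_at_right_filter; exact: cvg_id.
  rewrite mulr0 add0r in H; apply: cvg_trans H; apply: near_eq_cvg.
  near=> s; rewrite divfK ?subrK// gt_eqF//.
have /cvgr_distC_lt/(_ _ e0)[d1 /= d10 Hd1] := ycvg.
have /cvgr_distC_lt/(_ _ e0)[d2 /= d20 Hd2] := dy0.
pose s := Num.min t (Num.min d1 d2) / 2.
have m0 : 0 < Num.min t (Num.min d1 d2) by rewrite !lt_min t0 d10.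
have s0 : 0 < s by rewrite divr_gt0.
have : s < Num.min t (Num.min d1 d2) by rewrite /s; lra.
rewrite !lt_min => /and3P[st sd1 sd2].
(* At the mean value point [th] of [0, s], [dy th] equals the difference quotient at [s], which is
   close to [b] since s < [d2]. *)
have [||th] := @MVT R y dy 0 s s0.
- by move=> x; rewrite in_itv /= => /andP[x0 _]; exact: yE.
- apply/continuous_within_itvP => //; split => [x|//|].
  + rewrite in_itv /= => /andP[x0 _]; apply: differentiable_continuous.
    by apply/derivable1_diffP; have := yE x x0 => -[].
  + by rewrite y0.
  + apply: cvg_at_left_filter; apply: differentiable_continuous.
    by apply/derivable1_diffP; have := yE s s0 => -[].
rewrite in_itv /= => /andP[th0 ths] E.
exists th; first by rewrite th0 (lt_trans ths).
split.
  apply: Hd1 => //=; rewrite sub0r normrN gtr0_norm//; exact: lt_trans ths sd1.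
have -> : dy th = (y s - a) / s by rewrite -y0 E subr0 mulfK// gt_eqF.
by apply: Hd2 => //=; rewrite sub0r normrN gtr0_norm.
Unshelve. all: by end_near. Qed.

(** Convergence of [dy] to [b] is obtained along a sequence of times only; this is enough to compare
    a nonincreasing function of time with its value on the initial data. *)
Lemma damped_osc_seq r a b y dy t : damped_osc r a b y dy -> 0 < t ->
  exists s : R^nat, [/\ forall k, 0 < s k < t, s @ \oo --> 0,
    (y \o s) @ \oo --> a & (dy \o s) @ \oo --> b].
Proof.
move=> H t0.
have h0 k : 0 < (k.+1%:R : R)^-1 by rewrite invr_gt0 ltr0n.
have /choice[s Hs] : forall k : nat, exists s, 0 < s < Num.min t k.+1%:R^-1 /\
    (`|y s - a| < k.+1%:R^-1 /\ `|dy s - b| < k.+1%:R^-1).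
  move=> k; have [|s ? ?] := damped_osc_near0 H (t:=Num.min t k.+1%:R^-1) _ (h0 k).
    by rewrite lt_min t0 h0.
  by exists s.
have sq (u : R^nat) (c : R) : (forall k, `|u k - c| < k.+1%:R^-1) -> u @ \oo --> c.
  move=> Hu; apply/cvgrPdist_lt => e e0; near=> k.
  rewrite distrC (lt_trans (Hu k))//.
  by near: k; exact: near_infty_natSinv_lt (PosNum e0).
exists s; split.
- by move=> k; case: (Hs k); rewrite lt_min => /andP[-> /andP[->]].
- apply: sq => k; case: (Hs k) => /andP[s0].
  by rewrite lt_min => /andP[_ sk] _; rewrite subr0 gtr0_norm.
- by apply: sq => k; case: (Hs k) => _ [].
- by apply: sq => k; case: (Hs k) => _ [].
Unshelve. all: by end_near. Qed.

(** With g = r^4 / (2 + r^6), the function e^{g t} Q is nonincreasing for t > 0. The left side is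
    the part of Q that contains y, and the bracket on the right dominates Q at the initial data. *)
Lemma damped_osc_decay r a b y dy t : damped_osc r a b y dy -> 0 < t ->
  (r ^+ 2 + r ^+ 8 / 4) * y t ^+ 2 <=
  expR (- (r ^+ 4 / (2 + r ^+ 6) * t)) *
    (2 * b ^+ 2 + (r ^+ 2 + r ^+ 8) * a ^+ 2).
Proof.
move=> H t0; set g := r ^+ 4 / (2 + r ^+ 6).
have [_ _ dyE ddyE] := H.
have r6 : 0 <= r ^+ 6 by rewrite exprn_even_ge0.
have gd : g * (2 + r ^+ 6) = r ^+ 4 by rewrite /g divfK//; lra.
have g0 : 0 <= g by rewrite divr_ge0 ?exprn_even_ge0//; lra.
pose Q u v := (v + r ^+ 4 * u / 2) ^+ 2 + (r ^+ 2 + r ^+ 8 / 4) * u ^+ 2.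
pose L s := expR (g * s) * Q (y s) (dy s).
pose dL s := expR (g * s) * (g * Q (y s) (dy s) - r ^+ 4 * dy s ^+ 2 - r ^+ 6 * y s ^+ 2).
have LE (s : R) : 0 < s -> is_derive s 1 L (dL s).
  move=> s0; have D1 := dyE s s0; have D2 := ddyE s s0.
  have De := is_derive1_dilate (is_derive_expR (g * s)).
  have D3 := is_derive1D D2 (is_derive1Z (r ^+ 4 / 2) D1).
  have D4 := is_derive1D (is_derive1M D3 D3)
    (is_derive1Z (r ^+ 2 + r ^+ 8 / 4) (is_derive1M D1 D1)).
  have -> : L = fun s => expR (g * s) *
     ((dy s + (r ^+ 4 / 2) * y s) * (dy s + (r ^+ 4 / 2) * y s) +
      (r ^+ 2 + r ^+ 8 / 4) * (y s * y s)).
    by apply/funext => x; rewrite /L /Q; congr (_ * _); ring.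
  apply: is_derive_eq (is_derive1M De D4) _.
  by rewrite /dL /Q; field.
(* Substituting r^4 = g (2 + r^6) turns the bracket into - g times a sum of squares with nonnegative
   coefficients. *)
have dL0 (x : R) : dL x <= 0.
  rewrite /dL mulr_ge0_le0 ?expR_ge0//.
  rewrite /Q; set v := dy x; set u := y x.
  have -> : r ^+ 8 = r ^+ 2 * r ^+ 6 by ring.
  have -> : r ^+ 4 * v ^+ 2 = g * (2 + r ^+ 6) * v ^+ 2 by rewrite gd.
  have -> : r ^+ 6 * u ^+ 2 = g * (2 + r ^+ 6) * r ^+ 2 * u ^+ 2 by rewrite gd; ring.
  rewrite -[leLHS]opprK oppr_le0.
  have -> : - (g * ((v + r ^+ 4 * u / 2) ^+ 2 + (r ^+ 2 + r ^+ 2 * r ^+ 6 / 4) * u ^+ 2) -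
    g * (2 + r ^+ 6) * v ^+ 2 - g * (2 + r ^+ 6) * r ^+ 2 * u ^+ 2) =
    g * (r ^+ 6 * v ^+ 2 + (v - r ^+ 4 * u / 2) ^+ 2 + r ^+ 2 * u ^+ 2 +
      r ^+ 6 * r ^+ 2 * u ^+ 2 / 4) by field.
  by rewrite mulr_ge0//; repeat first [exact: exprn_even_ge0 | apply: addr_ge0 |
    apply: mulr_ge0 | by rewrite invr_ge0].
have Ldecr (s : R) : 0 < s < t -> L t <= L s.
  move=> /andP[s0 st].
  refine (@ler0_derive1_le_cc _ L s t _ _ _ t s _ _ _).
  - move=> x; rewrite in_itv /= => /andP[sx _].
    by have := LE x (lt_trans s0 sx) => -[].
  - move=> x; rewrite in_itv /= => /andP[sx _]; rewrite derive1E.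
    by have /@derive_val -> := LE x (lt_trans s0 sx).
  - apply: derivable_within_continuous => x; rewrite in_itv /= => /andP[sx _].
    by have := LE x (lt_le_trans s0 sx) => -[].
  - by rewrite in_itv /= lexx ltW.
  - by rewrite in_itv /= lexx ltW.
  - exact: ltW.
have [s [s0t scvg ycvg dycvg]] := damped_osc_seq H t0.
have Lcvg : (L \o s) @ \oo --> Q a b.
  rewrite -[X in _ --> X]mul1r -expR0 -[X in expR X](mulr0 g).
  apply: cvgM.
    apply: (cvg_comp _ expR); last exact: continuous_expR.
    by apply: cvgM => //; exact: cvg_cst.
  have cst (c : R) : (fun _ : nat => c) @ \oo --> c by exact: cvg_cst.
  have qcvg : (fun k => dy (s k) + r ^+ 4 * y (s k) / 2) @ \oo --> b + r ^+ 4 * a / 2.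
    by apply: cvgD => //; apply: cvgM => //; apply: cvgM.
  rewrite /Q !expr2; apply: cvgD; first exact: cvgM.
  by apply: cvgM => //; exact: cvgM.
(* Monotonicity holds between positive times; the initial time is reached in the limit along [s]. *)
have Lt : L t <= Q a b.
  rewrite -(cvg_lim _ Lcvg)//; apply: limr_ge; first by apply/cvg_ex; exists (Q a b).
  by apply: nearW => k /=; exact: Ldecr.
rewrite expRN ler_pdivlMl ?expR_gt0//.
apply: le_trans (_ : L t <= _); first by rewrite /L /Q ler_wpM2l ?expR_ge0// lerDr sqr_ge0.
apply: le_trans Lt _; rewrite /Q -subr_ge0.
(* What the bracket of the statement exceeds Q by, as a sum of squares. *)
rewrite (_ : _ - _ = (b - r ^+ 4 * a / 2) ^+ 2 + r ^+ 8 * a ^+ 2 / 4); last by field.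
by repeat first [exact: exprn_even_ge0 | apply: addr_ge0 | apply: mulr_ge0 |
  by rewrite invr_ge0].
Qed.

End damped_oscillator.

(** * Uniqueness and the explicit underdamped solution *)

Section explicit_solution.
Context {R : realType}.
Implicit Types (r a b t : R) (y dy z dz : R -> R).

Lemma is_derive_cvg_right (f : R -> R) (t df : R) : is_derive t 1 f df ->
  (f (t + s) - f t) / s @[s --> (0 : R)^'+] --> df.
Proof.
move=> [fd fE].
have /cvg_dnbhs_at_right h : h^-1 *: (f (h *: 1 + t) - f t) @[h --> (0 : R)^'] --> df.
  by rewrite -fE; exact: fd.
apply: cvg_trans h; apply: near_eq_cvg; apply: nearW => s.
by rewrite /GRing.scale /= mulr1 (addrC s) mulrC.
Qed.

Lemma lipschitz_of_derive (f df : R -> R) (u v : R) :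
  (forall x : R, is_derive x 1 f (df x)) -> (forall x, `|df x| <= 1) ->
  `|f u - f v| <= `|u - v|.
Proof.
move=> fE df1; wlog uv : u v / v <= u.
  move=> H; have [|/ltW uv] := leP v u; first exact: H.
  by rewrite distrC [leRHS]distrC; exact: H.
have [|c _ ->] := @MVT_segment R f df v u uv (fun x _ => fE x).
  by apply: derivable_within_continuous => x _; have := fE x => -[].
by rewrite normrM ler_piMl.
Qed.

Lemma sin_lipschitz (u v : R) : `|sin u - sin v| <= `|u - v|.
Proof.
apply: (@lipschitz_of_derive sin cos) => x; rewrite ler_norml.
by rewrite cos_geN1 cos_le1.
Qed.

Lemma cos_lipschitz (u v : R) : `|cos u - cos v| <= `|u - v|.
Proof.
apply: (@lipschitz_of_derive cos (fun x => - sin x)) => x; rewrite normrN ler_norml.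
by rewrite sin_geN1 sin_le1.
Qed.

Lemma damped_oscB r a b a' b' y dy z dz :
  damped_osc r a b y dy -> damped_osc r a' b' z dz ->
  damped_osc r (a - a') (b - b') (fun s => y s - z s) (fun s => dy s - dz s).
Proof.
move=> [y0 dy0 dyE ddyE] [z0 dz0 dzE ddzE]; split.
- by rewrite y0 z0.
- have -> : (fun s => (y s - z s - (a - a')) / s) =
      (fun s => (y s - a) / s - (z s - a') / s).
    by apply/funext => s; rewrite -mulrBl; congr (_ / _); ring.
  exact: cvgB.
- by move=> s s0; apply: is_deriveB; [exact: dyE|exact: dzE].
- move=> s s0; apply: is_derive_eq (is_deriveB (ddyE s s0) (ddzE s s0)) _.
  by ring.
Qed.

(** The difference of two solutions has zero data, so the decay estimate makes (r^2 + r^8 / 4) times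
    its square nonpositive. *)
Lemma damped_osc_inj r a b y dy z dz t : 0 < r -> 0 < t ->
  damped_osc r a b y dy -> damped_osc r a b z dz -> y t = z t.
Proof.
move=> r0 t0 H1 H2; have := damped_osc_decay (damped_oscB H1 H2) t0.
rewrite !subrr expr0n /= !mulr0 addr0 mulr0 => h.
apply/eqP; rewrite -subr_eq0 -sqrf_eq0 eq_le sqr_ge0 andbT.
by move: h; rewrite pmulr_rle0// addr_gt0 ?divr_gt0 ?exprn_gt0.
Qed.

(** The hypothesis on [w] says that the roots of X^2 + r^4 X + r^2 are - r^4 / 2 +/- i w. The
    coefficient of the sine is the one that gives initial velocity [b]. *)
Lemma damped_osc_explicit r a b w : r ^+ 2 = w ^+ 2 + (r ^+ 4 / 2) ^+ 2 ->
  w != 0 ->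
  exists dz, damped_osc r a b (fun t => expR (- (r ^+ 4 / 2) * t) *
    (a * cos (w * t) + (b + r ^+ 4 / 2 * a) / w * sin (w * t))) dz.
Proof.
set k := r ^+ 4 / 2 => wE w0; set c := b + k * a.
pose z t := expR (- k * t) * (a * cos (w * t) + c / w * sin (w * t)).
pose dz t := expR (- k * t) * (b * cos (w * t) + (- (a * w) - k * (c / w)) * sin (w * t)).
have zE (t : R) : is_derive t 1 z (dz t).
  have := is_derive1M (is_derive1_dilate (is_derive_expR (- k * t)))
    (is_derive1D (is_derive1Z a (is_derive1_dilate (is_derive_cos (w * t))))
      (is_derive1Z (c / w) (is_derive1_dilate (is_derive_sin (w * t))))).
  move=> h; apply: is_derive_eq h _.
  by rewrite /dz /c; field.
have dzE (t : R) : is_derive t 1 dz (- (r ^+ 2 * z t) - r ^+ 4 * dz t).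
  have := is_derive1M (is_derive1_dilate (is_derive_expR (- k * t)))
    (is_derive1D (is_derive1Z b (is_derive1_dilate (is_derive_cos (w * t))))
      (is_derive1Z (- (a * w) - k * (c / w)) (is_derive1_dilate (is_derive_sin (w * t))))).
  move=> h; apply: is_derive_eq h _.
  have -> : r ^+ 4 = 2 * k by rewrite /k; field.
  by rewrite wE /dz /z /c; field.
have z0 : z 0 = a by rewrite /z !mulr0 expR0 cos0 sin0; ring.
have dz0 : dz 0 = b by rewrite /dz !mulr0 expR0 cos0 sin0; ring.
exists dz; split => //.
have := is_derive_cvg_right (zE 0); rewrite z0 dz0.
by under eq_cvg do rewrite add0r.
Qed.

End explicit_solution.

(** * Frequency-wise error *)

Section low_frequencies.
Context {R : realType}.
Implicit Types (r a b t : R) (y dy z dz : R -> R).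

(** The asymptotic profile at |xi| = r, with [p0] and [p1] standing for the real, or the imaginary,
    parts of P_0 and P_1. *)
Definition profile (r t p0 p1 : R) : R :=
  p1 * (expR (- (t * r ^+ 4 / 2)) * (sin (t * r) / r))
  + p0 * (expR (- (t * r ^+ 4 / 2)) * cos (t * r)).

(** By uniqueness y is the explicit solution. Once the exponential is factored out, six errors
    remain: the data minus their values at frequency 0 (two terms), the replacement of w by r in the
    cosine, in the sine and in the amplitude 1 / w, and the damping term r^4 a / (2 w). *)
Lemma low_frequency_linear r t a b m0 m1 p0 p1 y dy :
  damped_osc r a b y dy -> 0 < r <= 1 -> 0 < t ->
  `|a - p0| <= r * m0 -> `|a| <= m0 -> `|b - p1| <= r * m1 -> `|b| <= m1 ->
  `|y t - profile r t p0 p1| <=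
  expR (- (t * r ^+ 4 / 2)) * ((2 + t * r ^+ 4) * (m0 * r + m1)).
Proof.
move=> H /andP[r0 r1] t0 hp0 ha hp1 hb.
pose w := r * Num.sqrt (1 - r ^+ 6 / 4).
have r4 : r ^+ 4 <= 1 by rewrite exprn_ile1// ltW.
have r3 : r ^+ 3 <= 1 by rewrite exprn_ile1// ltW.
have r2 : r ^+ 2 <= 1 by rewrite exprn_ile1// ltW.
have r6 : r ^+ 6 <= 1 by rewrite exprn_ile1// ltW.
have q0 : 0 <= 1 - r ^+ 6 / 4 by lra.
have w2 : w ^+ 2 = r ^+ 2 - r ^+ 8 / 4.
  by rewrite /w exprMn sqr_sqrtr//; field.
have wr : r ^+ 2 = w ^+ 2 + (r ^+ 4 / 2) ^+ 2 by rewrite w2; field.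
(* Since r^6 <= 1, the square root is at least 1/2. *)
have rw : r / 2 <= w.
  rewrite /w ler_pM2l//.
  rewrite -[leLHS](@ger0_norm _ 2^-1)// -sqrtr_sqr ler_sqrt//.
  by rewrite exprVn; lra.
have w0 : 0 < w by apply: lt_le_trans rw; lra.
have wler : w <= r.
  rewrite -(@ler_pXn2r _ 2) ?nnegrE ?(ltW w0) ?(ltW r0)// w2.
  by rewrite gerBl divr_ge0// exprn_ge0// ltW.
(* From (r - w) (r + w) = r^8 / 4 and r + w >= r. *)
have rBw : r - w <= r ^+ 7 / 4.
  rewrite -(@ler_pM2l _ r)//.
  have : (r - w) * (r + w) = r * (r ^+ 7 / 4) by rewrite -subr_sqr w2; field.
  by move=> <-; rewrite mulrC ler_wpM2l; lra.
have [dz Hz] := @damped_osc_explicit _ r a b w wr (lt0r_neq0 w0).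
rewrite (damped_osc_inj r0 t0 H Hz) /profile.
have -> : - (r ^+ 4 / 2) * t = - (t * r ^+ 4 / 2) by ring.
set e := expR _.
rewrite (_ : _ - _ = e * ((a - p0) * cos (t * r) + a * (cos (w * t) - cos (t * r))
  + (b - p1) / r * sin (t * r) + b * (sin (w * t) - sin (t * r)) / w
  + b * ((r - w) / (r * w)) * sin (t * r)
  + r ^+ 4 / 2 * a / w * sin (w * t))); last by field; rewrite !lt0r_neq0.
rewrite normrM (ger0_norm (expR_ge0 _)) ler_wpM2l ?expR_ge0//.
have m00 : 0 <= m0 by apply: le_trans ha.
have m10 : 0 <= m1 by apply: le_trans hb.
have cos1 x : `|cos x| <= 1 :> R by rewrite ler_norml cos_geN1 cos_le1.
have sin1 x : `|sin x| <= 1 :> R by rewrite ler_norml sin_geN1 sin_le1.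
have dwt : `|w * t - t * r| <= t * (r ^+ 7 / 4).
  rewrite mulrC -mulrBr normrM (gtr0_norm t0) ler_pM2l//.
  by rewrite distrC ger0_norm// subr_ge0.
have winv : w^-1 <= 2 / r by rewrite -[2 / r]invf_div lef_pV2 ?posrE// divr_gt0.
have T1 : `|(a - p0) * cos (t * r)| <= r * m0.
  by rewrite normrM -[leRHS]mulr1 ler_pM.
have T2 : `|a * (cos (w * t) - cos (t * r))| <= m0 * (t * (r ^+ 7 / 4)).
  by rewrite normrM ler_pM// (le_trans (cos_lipschitz _ _)).
have T3 : `|(b - p1) / r * sin (t * r)| <= m1.
  rewrite normrM -[leRHS]mulr1 ler_pM// normrM normfV (gtr0_norm r0).
  by rewrite ler_pdivrMr// mulrC.
have T4 : `|b * (sin (w * t) - sin (t * r)) / w| <= m1 * (t * (r ^+ 7 / 4)) * (2 / r).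
  rewrite normrM ler_pM//; last by rewrite gtr0_norm ?invr_gt0.
  by rewrite normrM ler_pM// (le_trans (sin_lipschitz _ _)).
have T5 : `|b * ((r - w) / (r * w)) * sin (t * r)| <= m1 * (r ^+ 7 / 4 / r * (2 / r)).
  rewrite normrM -[leRHS]mulr1 ler_pM// normrM ler_pM// invfM mulrA normrM ler_pM//.
    rewrite normrM ler_pM//; first by rewrite ger0_norm ?subr_ge0.
    by rewrite gtr0_norm ?invr_gt0.
  by rewrite gtr0_norm ?invr_gt0.
have T6 : `|r ^+ 4 / 2 * a / w * sin (w * t)| <= r ^+ 4 / 2 * m0 * (2 / r).
  rewrite normrM -[leRHS]mulr1 ler_pM// normrM ler_pM//; last first.
    by rewrite gtr0_norm ?invr_gt0.
  rewrite normrM ler_pM// ger0_norm// divr_ge0// exprn_ge0//; exact: ltW.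
apply: le_trans (_ : r * m0 + m0 * (t * (r ^+ 7 / 4)) + m1
    + m1 * (t * (r ^+ 7 / 4)) * (2 / r) + m1 * (r ^+ 7 / 4 / r * (2 / r))
    + r ^+ 4 / 2 * m0 * (2 / r) <= _).
  by do 5 (apply: le_trans (ler_normD _ _) _; apply: lerD => //).
(* The slack of the bound, grouped by [m0] and [m1]; both brackets are nonnegative because r <=
   1. *)
rewrite -subr_ge0 (_ : _ - _ =
   m0 * r * (1 - r ^+ 2 + t * r ^+ 4 * (1 - r ^+ 2 / 4))
   + m1 * (2 - 1 - r ^+ 5 / 2 + t * r ^+ 4 * (1 - r ^+ 2 / 2)));
  last by field; rewrite lt0r_neq0.
have r5 : r ^+ 5 <= 1 by rewrite exprn_ile1// ltW.
have tr : 0 <= t * r ^+ 4 by rewrite mulr_ge0 ?exprn_ge0// ltW.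
have q1 : 0 <= t * r ^+ 4 * (1 - r ^+ 2 / 4) by rewrite mulr_ge0//; lra.
have q2 : 0 <= t * r ^+ 4 * (1 - r ^+ 2 / 2) by rewrite mulr_ge0//; lra.
by apply: addr_ge0; apply: mulr_ge0 => //; [apply: mulr_ge0 => //; exact: ltW| |]; lra.
Qed.

(* With [x = t r^4], the factor [(2 + x)^2 e^{-x}] is absorbed by half of the
   exponential, and [x / 2 >= sqrt t r^2 - 1 / 2] leaves a Gaussian. *)
Lemma low_frequency_exp (r t : R) : 0 <= r -> 0 < t ->
  expR (- (t * r ^+ 4)) * (2 + t * r ^+ 4) ^+ 2 <=
    16 ^+ 2 * expR 2^-1 * expR (- (Num.sqrt t * r ^+ 2)) /\
  expR (- (t * r ^+ 4)) * (2 + t * r ^+ 4) ^+ 2 * r ^+ 2 <=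
    4 * 16 ^+ 2 * expR 2^-1 * expR (- (Num.sqrt t * r ^+ 2)) / Num.sqrt t.
Proof.
move=> r0 t0; set s := Num.sqrt t; have s0 : 0 < s by rewrite sqrtr_gt0.
have st : t = s ^+ 2 by rewrite sqr_sqrtr// ltW.
set z := s * r ^+ 2; have z0 : 0 <= z by rewrite mulr_ge0 ?exprn_ge0// ltW.
have xE : t * r ^+ 4 = z ^+ 2 by rewrite st /z; ring.
rewrite xE; set x := z ^+ 2; have x0 : 0 <= x by exact: sqr_ge0.
have E8 : 2 + x <= 16 * expR (x / 8).
  have := expR_ge1Dx (x / 8); lra.
(* Here (z / 2 - 1)^2 >= 0 gives z <= 1 + x / 4. *)
have E4 : z <= 4 * expR (x / 4).
  have := expR_ge1Dx (x / 4); have : 0 <= (z / 2 - 1) ^+ 2 by exact: sqr_ge0.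
  by rewrite /x; nra.
have sq8 : (2 + x) ^+ 2 <= 16 ^+ 2 * expR (x / 4).
  have -> : x / 4 = x / 8 + x / 8 by field.
  rewrite expRD.
  by rewrite (expr2 16) mulrACA expr2 ler_pM//; lra.
(* The exponents differ by x / 2 - z + 1 / 2 = (z - 1)^2 / 2. *)
have G : expR (- x) * expR (x / 4) * expR (x / 4) <= expR 2^-1 * expR (- z).
  rewrite -!expRD ler_expR -subr_ge0.
  rewrite (_ : _ - _ = (z - 1) ^+ 2 / 2) ?divr_ge0 ?sqr_ge0//.
  by rewrite /x; field.
have E1 : 1 <= expR (x / 4) by rewrite -expR0 ler_expR divr_ge0.
have h1 : expR (- x) * (2 + x) ^+ 2 <= 16 ^+ 2 * (expR (- x) * expR (x / 4)).
  by rewrite [leRHS]mulrCA ler_wpM2l ?expR_ge0.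
split.
  apply: le_trans h1 _; rewrite -(mulrA (16 ^+ 2)) ler_wpM2l//.
  by apply: le_trans G; apply: ler_peMr => //; rewrite mulr_ge0 ?expR_ge0.
(* Multiplied by [s], the factor r^2 becomes z, which the second e^{x / 4} absorbs. *)
rewrite ler_pdivlMr//.
have -> : expR (- x) * (2 + x) ^+ 2 * r ^+ 2 * s = expR (- x) * (2 + x) ^+ 2 * z.
  by rewrite /z; ring.
apply: le_trans (_ : 16 ^+ 2 * (expR (- x) * expR (x / 4)) * (4 * expR (x / 4)) <= _).
  by rewrite ler_pM// mulr_ge0 ?expR_ge0 ?sqr_ge0.
rewrite (_ : _ * (4 * _) = 4 * 16 ^+ 2 * (expR (- x) * expR (x / 4) * expR (x / 4))); last by ring.
by rewrite -(mulrA (4 * 16 ^+ 2)) ler_wpM2l.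
Qed.

(** The linear bound is squared with (m0 r + m1)^2 <= 2 (m1^2 + m0^2 r^2). The factor r^2 beside
    m0^2 is what yields the extra 1 / sqrt t, and 8 is this 2 times the 4 of the exponential
    bound. *)
Lemma low_frequency r t a b m0 m1 p0 p1 y dy :
  damped_osc r a b y dy -> 0 < r <= 1 -> 0 < t ->
  `|a - p0| <= r * m0 -> `|a| <= m0 -> `|b - p1| <= r * m1 -> `|b| <= m1 ->
  (y t - profile r t p0 p1) ^+ 2 <=
  8 * 16 ^+ 2 * expR 2^-1 * expR (- (Num.sqrt t * r ^+ 2))
    * (m1 ^+ 2 + m0 ^+ 2 / Num.sqrt t).
Proof.
move=> H r01 t0 hp0 ha hp1 hb; have /andP[r0 r1] := r01.
have := low_frequency_linear H r01 t0 hp0 ha hp1 hb.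
have [G1 G2] := low_frequency_exp (ltW r0) t0.
set x := t * r ^+ 4 in G1 G2 *; set D := _ - _; move=> h.
apply: le_trans (_ : expR (- x) * (2 + x) ^+ 2 * (m0 * r + m1) ^+ 2 <= _).
  have -> : expR (- x) = expR (- (x / 2)) ^+ 2.
    by rewrite expr2 -expRD; congr expR; field.
  by rewrite -!exprMn -mulrA -(real_normK (num_real D)) lerXn2r// nnegrE (le_trans _ h).
apply: le_trans (_ : expR (- x) * (2 + x) ^+ 2 * (2 * (m1 ^+ 2 + m0 ^+ 2 * r ^+ 2)) <= _).
  apply: ler_wpM2l; first by rewrite mulr_ge0 ?expR_ge0 ?sqr_ge0.
  rewrite -subr_ge0 (_ : _ - _ = (m0 * r - m1) ^+ 2); last by ring.
  exact: sqr_ge0.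
have M1 := ler_wpM2r (mulr_ge0 (ler0n R 2) (sqr_ge0 m1)) G1.
have M2 := ler_wpM2r (mulr_ge0 (ler0n R 2) (sqr_ge0 m0)) G2.
have P1 : 0 <= expR 2^-1 * expR (- (Num.sqrt t * r ^+ 2)) * m1 ^+ 2.
  by apply: mulr_ge0; [apply: mulr_ge0; exact: expR_ge0|exact: sqr_ge0].
move: M1 M2 P1; set E := expR (- x) * _; set A := _ * expR (- (Num.sqrt t * _)).
set s := (Num.sqrt t)^-1 => M1 M2 P1.
rewrite (_ : E * _ = E * (2 * m1 ^+ 2) + E * r ^+ 2 * (2 * m0 ^+ 2)); last by ring.
apply: le_trans (lerD M1 M2) _; rewrite -subr_ge0.
rewrite (_ : _ - _ = 6 * 16 ^+ 2 *
  (expR 2^-1 * expR (- (Num.sqrt t * r ^+ 2)) * m1 ^+ 2)); last by rewrite /A -/s; ring.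
by apply: mulr_ge0.
Qed.

End low_frequencies.

(** * High frequencies, r >= 1 *)

Section high_frequencies.
Context {R : realType}.
Implicit Types (r a b t : R) (y dy z dz : R -> R).

(** In logarithms this is l ln (s / l) <= s, a case of ln x <= x. *)
Lemma expRN_le_powR (l s : R) : 0 < l -> 0 < s -> expR (- s) <= (l / s) `^ l.
Proof.
move=> l0 s0; have sl : 0 < s / l by rewrite divr_gt0.
rewrite /powR gt_eqF ?divr_gt0// ler_expR -invf_div lnV ?posrE//.
have /(ler_wpM2l (ltW l0)) : ln (s / l) <= s / l.
  exact/ltW/ln_sublinear.
by rewrite mulrN lerN2 mulrCA divff ?mulr1// gt_eqF.
Qed.

(** No cancellation is sought: y^2 and the square of the profile are bounded separately, and (y -
    profile)^2 is at most twice their sum. *)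
Lemma high_frequency (l r t a b p0 p1 : R) y dy :
  damped_osc r a b y dy -> 1 <= l -> 1 <= r -> 1 <= t ->
  (y t - profile r t p0 p1) ^+ 2 <=
  8 * (3 * l) `^ l * (t `^ (- l) *
    (r `^ (2 * (l - 1)) * b ^+ 2 + r `^ (2 * l) * a ^+ 2))
  + 4 * expR 1 * (expR (- t) * expR (- r ^+ 2) * (p1 ^+ 2 + p0 ^+ 2)).
Proof.
move=> H l1 r1 t1.
have r0 : 0 < r by exact: lt_le_trans r1.
have t0 : 0 < t by exact: lt_le_trans t1.
have l0 : 0 < l by exact: lt_le_trans l1.
have r2 : 0 < r ^+ 2 by exact: exprn_gt0.
have r6 : 1 <= r ^+ 6 by exact: exprn_ege1.
have r8 : 0 < r ^+ 8 by exact: exprn_gt0.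
set prof := profile _ _ _ _.
have E : expR (- (r ^+ 4 / (2 + r ^+ 6) * t)) <= (3 * l) `^ l * (t `^ (- l) * r `^ (2 * l)).
  set s := t / (3 * r ^+ 2).
  have s0 : 0 < s by rewrite divr_gt0// mulr_gt0.
  apply: le_trans (_ : expR (- s) <= _).
    rewrite ler_expR lerN2 /s (mulrC _ t) ler_pM2l// -[leLHS]mul1r ler_pdivrMr ?mulr_gt0//.
    rewrite mulrAC ler_pdivlMr ?addr_gt0// ?(lt_le_trans _ r6)//.
    rewrite (_ : r ^+ 4 * _ = 3 * r ^+ 6); last by ring.
    by lra.
  rewrite (_ : (3 * l) `^ l * _ = (l / s) `^ l); first exact: expRN_le_powR.
  have -> : r `^ (2 * l) = (r ^+ 2) `^ l by rewrite powRrM powR_mulrn ?(ltW r0).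
  have -> : t `^ (- l) = t^-1 `^ l by rewrite -powR_inv1 ?(ltW t0)// -powRrM mulN1r.
  have tr : 0 <= t^-1 * r ^+ 2 by rewrite ltW// mulr_gt0// invr_gt0.
  have l3 : 0 <= 3 * l by rewrite ltW// mulr_gt0.
  rewrite -powRM ?invr_ge0 ?(ltW t0) ?(ltW r2)// -powRM//.
  congr (_ `^ _).
  by rewrite /s; field; rewrite !gt_eqF.
(* Dividing by the weight r^2 + r^8 / 4 gains r^{-2} on b^2, whence the exponent l - 1 for the
   second datum; the 4 matches r^8 with r^8 / 4. *)
have yle : y t ^+ 2 <= expR (- (r ^+ 4 / (2 + r ^+ 6) * t)) * (4 * (b ^+ 2 / r ^+ 2 + a ^+ 2)).
  have := damped_osc_decay H t0; set e := expR _ => h.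
  have c0 : 0 < r ^+ 2 + r ^+ 8 / 4 by rewrite addr_gt0// divr_gt0.
  rewrite -(ler_pM2l c0); apply: le_trans h _; rewrite [leRHS]mulrCA; apply: ler_wpM2l.
    exact: expR_ge0.
  rewrite -subr_ge0 (_ : _ - _ = 2 * b ^+ 2 + r ^+ 6 * b ^+ 2 + 3 * r ^+ 2 * a ^+ 2).
    by rewrite !addr_ge0//; apply: mulr_ge0; rewrite ?sqr_ge0// ?mulr_ge0 ?ltW// (lt_le_trans _ r6).
  by field; rewrite gt_eqF.
have rl : r `^ (2 * (l - 1)) = r `^ (2 * l) / r ^+ 2.
  rewrite mulrBr mulr1 powRB; first by rewrite powR_mulrn ?(ltW r0).
  by rewrite (gt_eqF r0) implybT.
have profle : prof ^+ 2 <= 2 * expR 1 * (expR (- t) * expR (- r ^+ 2) * (p1 ^+ 2 + p0 ^+ 2)).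
  rewrite /prof /profile; set e := expR (- (t * r ^+ 4 / 2)).
  have cs := cos2Dsin2 (t * r); have c2 := sqr_ge0 (cos (t * r)).
  have s2 := sqr_ge0 (sin (t * r)).
  (* Here t r^4 >= t r^2 >= t + r^2 - 1, the last step being (t - 1) (r^2 - 1) >= 0. The factor e^{-
     r^2} is kept for integrability over the frequencies. *)
  have e2 : e ^+ 2 <= expR 1 * (expR (- t) * expR (- r ^+ 2)).
    rewrite expr2 -!expRD ler_expR.
    have r24 : r ^+ 2 <= r ^+ 4 by apply: ler_weXn2l.
    have : 0 <= t * (r ^+ 4 - r ^+ 2) by rewrite mulr_ge0 ?subr_ge0 ?(ltW t0).
    have : 0 <= (t - 1) * (r ^+ 2 - 1) by rewrite mulr_ge0 ?subr_ge0 ?exprn_ege1.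
    by lra.
  have sr : (sin (t * r) / r) ^+ 2 <= 1.
    rewrite expr_div_n ler_pdivrMr// mul1r; have : 1 <= r ^+ 2 by exact: exprn_ege1.
    by lra.
  apply: le_trans (_ : e ^+ 2 * (2 * (p1 ^+ 2 + p0 ^+ 2)) <= _); last first.
    rewrite (_ : 2 * expR 1 * _ = expR 1 * (expR (- t) * expR (- r ^+ 2))
      * (2 * (p1 ^+ 2 + p0 ^+ 2))); last by ring.
    by apply: ler_wpM2r => //; rewrite mulr_ge0// addr_ge0 ?sqr_ge0.
  set S := sin _ / r in sr *; set K := cos _ in cs c2 *.
  rewrite (_ : p1 * _ + _ = e * (p1 * S + p0 * K)); last by ring.
  rewrite exprMn; apply: ler_wpM2l; first exact: sqr_ge0.
  apply: le_trans (_ : 2 * (p1 ^+ 2 * S ^+ 2 + p0 ^+ 2 * K ^+ 2) <= _).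
    rewrite -subr_ge0 (_ : _ - _ = (p1 * S - p0 * K) ^+ 2); last by ring.
    exact: sqr_ge0.
  rewrite ler_pM2l//; apply: lerD; rewrite -[leRHS]mulr1; apply: ler_wpM2l; rewrite ?sqr_ge0//.
  by lra.
apply: (@le_trans _ _ (2 * (y t ^+ 2 + prof ^+ 2))).
  rewrite -subr_ge0 (_ : 2 * _ - _ = (y t + prof) ^+ 2) ?sqr_ge0//; ring.
rewrite mulrDr; apply: lerD; last first.
  rewrite (_ : 4 * expR 1 * _ = 2 * (2 * expR 1
    * (expR (- t) * expR (- r ^+ 2) * (p1 ^+ 2 + p0 ^+ 2)))); last by ring.
  by rewrite ler_pM2l.
have ba0 : 0 <= 4 * (b ^+ 2 / r ^+ 2 + a ^+ 2).
  by rewrite mulr_ge0// addr_ge0 ?divr_ge0 ?sqr_ge0.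
have := ler_wpM2l (ler0n R 2) (le_trans yle (ler_wpM2r ba0 E)) => h.
apply: le_trans h _; rewrite rl le_eqVlt; apply/orP; left; apply/eqP.
by field; rewrite gt_eqF.
Qed.

End high_frequencies.

(** * From the complex equation to its real and imaginary parts *)

Section complex_to_real.
Context {R : realType}.
Variable p : R[i] -> R.
Hypothesis pD : {morph p : z w / z + w}.
Hypothesis pZ : forall (x : R) z, p (real_complex R x * z) = x * p z.
Hypothesis p_le : forall z, `|p z| <= Normc.normc z.

Let pB z w : p (z - w) = p z - p w.
Proof.
rewrite -mulN1r pD -[X in p (X * w)](_ : real_complex R (-1) = _) ?pZ ?mulN1r//.
by rewrite rmorphN rmorph1.
Qed.

(** An epsilon-delta form that serves both the two-sided derivative at t > 0 and the right
    difference quotient at 0. *)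
Lemma is_derive_nonneg_dist y t d e : is_derive_nonneg y t d -> 0 < e ->
  exists2 k : R, 0 < k & forall s : R, `|t - s| < k -> s != t -> 0 <= s ->
    `|(s - t)^-1 * (p (y s) - p (y t)) - p d| < e.
Proof.
move=> /cvgrPdist_lt/[apply]; rewrite near_withinE => -[k /= k0 Hk].
exists k => // s st sNt s0; have := Hk s st sNt.
rewrite /= in_itv /= s0 => /(_ erefl).
rewrite sub0r normrN; apply: le_lt_trans; apply: le_trans (ler_norm _).
by apply: le_trans (p_le _); rewrite !pB pZ pB.
Qed.

Lemma is_derive_of_nonneg y t d : 0 < t -> is_derive_nonneg y t d ->
  is_derive t 1 (p \o y) (p d).
Proof.
move=> t0 H.
have h : (fun h : R => h^-1 *: ((p \o y) (h *: 1 + t) - (p \o y) t)) @ 0^' --> p d.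
  apply/cvgrPdist_lt => e e0.
  have [k k0 Hk] := is_derive_nonneg_dist H e0.
  (* Increments smaller than [t] keep t + h nonnegative, where the one-sided derivative applies. *)
  exists (Num.min k t) => /=; first by rewrite lt_min k0.
  move=> h /=; rewrite sub0r normrN lt_min => /andP[hk ht] h0.
  have := Hk (h + t); rewrite opprD addrCA subrr addr0 normrN => /(_ hk).
  rewrite -subr_eq0 addrK => /(_ h0).
  rewrite distrC /GRing.scale /= mulr1; apply.
  by move: ht; rewrite ltr_norml => /andP[]; lra.
by split; [apply/cvg_ex; exists (p d)|exact: cvg_lim].
Qed.

Lemma cvg_right_of_nonneg y d : is_derive_nonneg y 0 d ->
  ((p \o y) s - (p \o y) 0) / s @[s --> (0 : R)^'+] --> p d.
Proof.
move=> H; apply/cvgrPdist_lt => e e0.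
have [k k0 Hk] := is_derive_nonneg_dist H e0.
exists k => // s /= sk s0; have := Hk s sk (lt0r_neq0 s0) (ltW s0).
by rewrite subr0 distrC [_ / s]mulrC.
Qed.

(** The equation has real coefficients, so the real-linear [p] maps its solutions to solutions. *)
Lemma damped_osc_of_fourier_ode r (a b : R[i]) y : fourier_ode r a b y ->
  exists dy, damped_osc r (p a) (p b) (p \o y) dy.
Proof.
move=> [dy [dyE y0 dy0 ddyE]]; exists (p \o dy); split.
- by rewrite /= y0.
- by move: (cvg_right_of_nonneg (dyE 0 (lexx 0))); rewrite /= y0 dy0.
- by move=> t t0; apply: is_derive_of_nonneg => //; apply: dyE; exact: ltW.
- move=> t t0; have [ddy H E] := ddyE t t0.
  apply: is_derive_eq (is_derive_of_nonneg t0 H) _ => /=.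
  have := congr1 p E; rewrite !pD !pZ.
  have -> : p 0 = 0 by rewrite -(subrr (0 : R[i])) pB subrr.
  by lra.
Qed.

End complex_to_real.

(** * Lebesgue measure on R^n *)

Section Rn_measure.
Context {R : realType}.
Local Open Scope ereal_scope.

(** Tonelli's theorem, the measure being the image of a product measure under [consRn]. *)
Lemma ge0_integral_Rn_cons n (f : Rn R n.+1 -> \bar R) :
  measurable_fun setT f -> (forall v, 0 <= f v) ->
  \int[@lebesgue_Rn R n.+1]_v f v =
  \int[lebesgue_measure]_x \int[@lebesgue_Rn R n]_v f (consRn (x, v)).
Proof.
move=> mf f0.
have mcons := @measurable_consRn R n.
transitivity (\int[(@lebesgue_measure R \x @lebesgue_Rn R n)]_z (f \o consRn) z).
  exact: (@ge0_integral_pushforward _ _ _ _ _ consRn mcons).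
rewrite fubini_tonelli1//=; first exact: measurableT_comp.
Qed.

Lemma normRn_ge0 n (v : Rn R n) : (0 <= normRn v)%R.
Proof. exact: sqrtr_ge0. Qed.

Lemma sqr_normRn n (v : Rn R n) : (normRn v ^+ 2 = dotRn v v)%R.
Proof. by rewrite sqr_sqrtr//; apply: sumr_ge0 => i _; rewrite -expr2 sqr_ge0. Qed.

Lemma sqr_normRn_cons n x (v : Rn R n) :
  (normRn (consRn (x, v)) ^+ 2 = x ^+ 2 + normRn v ^+ 2)%R.
Proof.
rewrite !sqr_normRn /dotRn big_ord_recl/= -expr2; congr (_ + _)%R.
by apply: eq_bigr => i _; rewrite !(tnth_nth 0%R).
Qed.

Lemma measurable_dotRn n d (T : measurableType d) (f g : T -> Rn R n) :
  measurable_fun setT f -> measurable_fun setT g ->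
  measurable_fun setT (fun z => dotRn (f z) (g z)).
Proof.
move=> mf mg; apply: measurable_sum => i.
apply: measurable_funM.
  exact: (measurableT_comp (measurable_tnth i) mf).
exact: (measurableT_comp (measurable_tnth i) mg).
Qed.

Lemma measurable_normRn n : measurable_fun setT (@normRn R n).
Proof.
have -> : @normRn R n = (fun v => dotRn v v `^ 2^-1)%R.
  by apply/funext => v; rewrite powR12_sqrt// -sqr_normRn sqr_ge0.
apply: (measurableT_comp (measurable_powR _)).
by apply: measurable_dotRn; exact: measurable_id.
Qed.

(** This is the normalisation of the centred normal density of variance 1 / (2 a). *)
Lemma integral_gaussian (a : R) : (0 < a)%R ->
  \int[lebesgue_measure]_x (expR (- (a * x ^+ 2)))%:E = (Num.sqrt (pi / a))%:E.
Proof.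
move=> a0; pose s : R := Num.sqrt (2 * a)^-1.
have a2 : (0 < (2 * a)^-1)%R by rewrite invr_gt0 mulr_gt0.
have s0 : (s != 0)%R by rewrite gt_eqF// sqrtr_gt0.
have s2 : (s ^+ 2 = (2 * a)^-1)%R by rewrite sqr_sqrtr// ltW.
have := integral_normal_pdf 0%R s; rewrite normal_pdfE//.
under eq_integral do rewrite EFinM.
rewrite ge0_integralZl//; last 3 first.
- by apply/measurable_EFinP; exact: measurable_normal_fun.
- by move=> x _; rewrite lee_fin normal_fun_ge0.
- by rewrite lee_fin normal_peak_ge0.
have pE : ((normal_peak s)^-1 = Num.sqrt (pi / a))%R.
  rewrite /normal_peak invrK s2; congr Num.sqrt.
  by field; rewrite gt_eqF.
under eq_integral => x _.
  rewrite /normal_fun subr0 s2 (_ : _ / _ = - (a * x ^+ 2))%R; last first.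
    by field; rewrite gt_eqF.
  over.
move=> /(congr1 (fun z => (Num.sqrt (pi / a))%:E * z)).
by rewrite mule1 -pE muleA -EFinM mulVf ?mul1e// gt_eqF// normal_peak_gt0.
Qed.

Lemma integral_gaussian_Rn n (a : R) : (0 < a)%R ->
  \int[@lebesgue_Rn R n]_v (expR (- (a * normRn v ^+ 2)))%:E =
  (Num.sqrt (pi / a) ^+ n)%:E.
Proof.
move=> a0.
have mg k : measurable_fun setT
    (fun v : Rn R k => (expR (- (a * normRn v ^+ 2)))%:E).
  apply/measurable_EFinP; apply: measurableT_comp => //.
  apply: measurableT_comp => //; apply: measurable_funM => //.
  by apply: measurable_funX; exact: measurable_normRn.
elim: n => [|n IH].
  (* In dimension 0 the measure is a unit mass at the empty tuple, whose norm is 0. *)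
  rewrite [LHS](@integral_dirac _ _ _ _ setT)//=; last exact: (mg 0%N).
  by rewrite diracE mem_set// mul1e sqr_normRn /dotRn big_ord0 mulr0 oppr0 expR0.
rewrite ge0_integral_Rn_cons//.
under eq_integral => x _.
  under eq_integral => v _.
    rewrite sqr_normRn_cons mulrDr opprD expRD EFinM.
    over.
  rewrite ge0_integralZl//; last exact: mg.
  rewrite IH.
  over.
rewrite ge0_integralZr//; last first.
  apply/measurable_EFinP; apply: measurableT_comp => //.
  by apply: measurableT_comp => //; apply: measurable_funM.
by rewrite integral_gaussian// -EFinM exprS.
Qed.

(** The origin lies in the hyperplane where the first coordinate vanishes, a product with the null
    factor {0}. *)
Lemma ae_normRn_gt0 n : (0 < n)%N ->
  {ae @lebesgue_Rn R n, forall v, (0 < normRn v)%R}.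
Proof.
case: n => // n _; exists ((fun v : Rn R n.+1 => tnth v ord0) @^-1` [set 0%R]); split.
- rewrite -[X in measurable X]setTI; apply: (@measurable_tnth _ _ n.+1 ord0) => //.
- rewrite [LHS](_ : _ = (@lebesgue_measure R \x @lebesgue_Rn R n)%E ([set 0%R] `*` setT)).
    rewrite product_measure1E// [X in X * _](_ : _ = 0%:E) ?mul0e//.
    exact: lebesgue_measure_set1.
  rewrite [LHS]/(lebesgue_cons _ _) /lebesgue_cons /pushforward; congr (_ _).
  by apply/seteqP; split => -[x v] //= [].
move=> v /= v0; have nv0 : normRn v = 0%R.
  by apply/eqP; rewrite eq_le normRn_ge0 andbT leNgt; apply/negP.
have := sqr_normRn v; rewrite nv0 expr0n /= /dotRn => /esym/eqP.
rewrite psumr_eq0; last by move=> i _; rewrite -expr2 sqr_ge0.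
by move=> /allP/(_ ord0 (mem_index_enum _)); rewrite /= mulf_eq0 orbb => /eqP.
Qed.

End Rn_measure.

(** * Fourier integrals of functions with a first moment *)

(** Cauchy-Schwarz: with X = |x|^2, Y = |y|^2 and D = x.y, the quantity Y (X Y - D^2) is the sum of
    the squares (Y x_i - D y_i)^2. If Y = 0, then y = 0 and D = 0. *)
Lemma dotRn_le (R : realType) n (x y : Rn R n) :
  `|dotRn x y| <= normRn x * normRn y.
Proof.
pose X := dotRn x x; pose Y := dotRn y y; pose D := dotRn x y.
have Y0 : 0 <= Y by rewrite -[Y]sqr_normRn sqr_ge0.
have H : 0 <= Y * (X * Y - D ^+ 2).
  have -> : Y * (X * Y - D ^+ 2) =
      \sum_(i < n) (Y * tnth x i - D * tnth y i : R) ^+ 2.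
    transitivity (\sum_(i < n) (Y ^+ 2 * ((tnth x i : R) * tnth x i)
       + (- (2 * Y * D)) * ((tnth x i : R) * tnth y i)
       + D ^+ 2 * ((tnth y i : R) * tnth y i))).
      rewrite !big_split /= -!mulr_sumr -/(dotRn x x) -/(dotRn y y) -/(dotRn x y).
      by rewrite -/X -/Y -/D; ring.
    by apply: eq_bigr => i _; ring.
  by apply: sumr_ge0 => i _; exact: sqr_ge0.
have HD : D ^+ 2 <= X * Y.
  have [Ygt|] := ltP 0 Y.
    by rewrite -subr_ge0 -(pmulr_rge0 _ Ygt).
  move=> Yle; have YE : Y == 0 by rewrite eq_le Yle.
  have -> : D = 0.
    rewrite /D /dotRn big1// => i _.
    move: YE; rewrite psumr_eq0; last by move=> j _; rewrite -expr2 sqr_ge0.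
    move=> /allP/(_ i (mem_index_enum _)); rewrite /= mulf_eq0 orbb => /eqP ->.
    by rewrite mulr0.
  by rewrite (eqP YE) mulr0 expr0n.
rewrite -(@ler_pXn2r _ 2) ?nnegrE ?mulr_ge0 ?normRn_ge0//.
by rewrite real_normK ?num_real// exprMn !sqr_normRn.
Qed.

Section oscillatory_integral.
Context {R : realType} {n : nat}.
Local Notation mu := (@lebesgue_Rn R n).
Variables g h F : Rn R n -> R.
Hypotheses (mg : measurable_fun setT g) (mh : measurable_fun setT h).
Hypotheses (gF : forall x, `|g x| <= F x) (hF : forall x, `|h x| <= F x).

(** The common shape of the real and imaginary parts of e^{- i x.xi} f(x): [g] and [h] stand for the
    parts of f up to sign, and [F] for its modulus. *)
Let k (xi x : Rn R n) : R := cos (dotRn x xi) * g x + sin (dotRn x xi) * h x.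

Let mk2 : measurable_fun setT (fun z : Rn R n * Rn R n => k z.1 z.2).
Proof.
have md : measurable_fun setT (fun z : Rn R n * Rn R n => dotRn z.2 z.1).
  by apply: measurable_dotRn; [exact: measurable_snd|exact: measurable_fst].
apply: measurable_funD; apply: measurable_funM.
- exact: (measurableT_comp (continuous_measurable_fun (@continuous_cos R)) md).
- exact: (measurableT_comp mg measurable_snd).
- exact: (measurableT_comp (continuous_measurable_fun (@continuous_sin R)) md).
- exact: (measurableT_comp mh measurable_snd).
Qed.

Let mk xi : measurable_fun setT (k xi).
Proof. exact: (measurableT_comp mk2 (measurable_pair1 xi)). Qed.

(** Tonelli's theorem gives measurability in the parameter for nonnegative integrands, hence the
    split into positive and negative parts. *)
Lemma measurable_osc_integral :
  measurable_fun setT (fun xi => \int[mu]_x (cos (dotRn x xi) * g x + sin (dotRn x xi) * h x)).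
Proof.
apply: (measurableT_comp (f := fine)); first exact: fine_measurable.
have -> : (fun xi => \int[mu]_x (k xi x)%:E)%E =
   (fun xi => \int[mu]_x ((fun z => (k z.1 z.2)%:E)^\+ (xi, x))
            - \int[mu]_x ((fun z => (k z.1 z.2)%:E)^\- (xi, x)))%E.
  apply/funext => xi; rewrite [LHS]integralE; congr (_ - _)%E.
    by apply: eq_integral => x _; rewrite !funeposE.
  by apply: eq_integral => x _; rewrite !funenegE.
have mk2E : measurable_fun setT (fun z : Rn R n * Rn R n => (k z.1 z.2)%:E).
  exact/measurable_EFinP.
apply: emeasurable_funB.
  exact: (measurable_fun_fubini_tonelli_F (m2:=mu) _ (measurable_funepos mk2E)
    (fun z => funepos_ge0 _ z)).
exact: (measurable_fun_fubini_tonelli_F (m2:=mu) _ (measurable_funeneg mk2E)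
  (fun z => funeneg_ge0 _ z)).
Qed.

Hypothesis iF : mu.-integrable setT (EFin \o F).

Let F0 x : 0 <= F x. Proof. exact: le_trans (gF x). Qed.

Lemma osc_integral0_le : `|\int[mu]_x g x| <= \int[mu]_x F x.
Proof.
have ig : mu.-integrable setT (EFin \o g).
  apply: (le_integrable measurableT) iF => //; first exact/measurable_EFinP.
  by move=> x _; rewrite /= lee_fin (le_trans (gF x))// ler_norm.
apply: le_trans (le_normr_Rintegral _ ig) _ => //.
apply: le_Rintegral => //; first exact: integrable_norm.
Qed.

Let k_le xi x : `|k xi x| <= 2 * F x.
Proof.
rewrite /k (le_trans (ler_normD _ _))// mulr_natl mulr2n; apply: lerD.
  by rewrite normrM -[leRHS]mul1r ler_pM// ler_norml cos_geN1 cos_le1.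
by rewrite normrM -[leRHS]mul1r ler_pM// ler_norml sin_geN1 sin_le1.
Qed.

Let iF2 : mu.-integrable setT (EFin \o (fun x => 2 * F x)).
Proof. exact: (integrableZl measurableT 2 iF). Qed.

Let ik xi : mu.-integrable setT (EFin \o k xi).
Proof.
apply: (le_integrable measurableT) iF2 => //; first exact/measurable_EFinP.
by move=> x _; rewrite /= lee_fin (le_trans (k_le xi x))// ler_norm.
Qed.

Lemma osc_integral_le xi :
  `|\int[mu]_x (cos (dotRn x xi) * g x + sin (dotRn x xi) * h x)| <=
  2 * \int[mu]_x F x.
Proof.
apply: le_trans (le_normr_Rintegral _ (ik xi)) _ => //.
rewrite -RintegralZl//; apply: le_Rintegral => //; exact: integrable_norm.
Qed.

(** Since cos and sin are 1-Lipschitz, replacing the phase x.xi by 0 costs at most |x| |xi| in each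
    of the two terms, and this is integrable against [F] by the first moment. *)
Lemma osc_integralB_le xi :
  mu.-integrable setT (EFin \o (fun x => normRn x * F x)) ->
  `|\int[mu]_x (cos (dotRn x xi) * g x + sin (dotRn x xi) * h x)
    - \int[mu]_x g x| <= normRn xi * (2 * \int[mu]_x (normRn x * F x)).
Proof.
move=> iNF.
have ig : mu.-integrable setT (EFin \o g).
  apply: (le_integrable measurableT) iF => //; first exact/measurable_EFinP.
  by move=> x _; rewrite /= lee_fin (le_trans (gF x))// ler_norm.
rewrite -RintegralB//; last exact: ik.
have ikg : mu.-integrable setT (EFin \o (fun x => k xi x - g x)).
  exact: (integrableB measurableT (ik xi) ig).
apply: le_trans (le_normr_Rintegral _ ikg) _ => //.
rewrite mulrA -RintegralZl//; apply: le_Rintegral => //.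
- exact: integrable_norm.
- exact: (integrableZl measurableT _ iNF).
move=> x _; rewrite /k.
have d := dotRn_le x xi; set th := dotRn x xi in d *.
rewrite (_ : _ - g x = (cos th - cos 0) * g x + (sin th - sin 0) * h x); last first.
  by rewrite cos0 sin0; ring.
apply: le_trans (_ : 2 * (`|th| * F x) <= _); last first.
  rewrite [leRHS](_ : _ = 2 * (normRn x * normRn xi * F x)); last by ring.
  by rewrite ler_pM2l// ler_wpM2r.
rewrite (le_trans (ler_normD _ _))// mulr_natl mulr2n.
have c := cos_lipschitz th 0; have s := sin_lipschitz th 0; rewrite subr0 in c s.
by rewrite !normrM lerD// ler_pM.
Qed.

End oscillatory_integral.

(** * Bounds on the real and imaginary parts of Fourier transforms *)

Section fourier_bounds.
Context {R : realType} {n : nat}.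
Local Notation mu := (@lebesgue_Rn R n).
Implicit Types (z w : R[i]) (f : Rn R n -> R[i]).

Lemma normc_sqrE z : Normc.normc z ^+ 2 = complex.Re z ^+ 2 + complex.Im z ^+ 2.
Proof. by case: z => a b; rewrite /Normc.normc sqr_sqrtr// addr_ge0 ?sqr_ge0. Qed.

Lemma normc_ge0 z : 0 <= Normc.normc z.
Proof. by case: z => a b; exact: sqrtr_ge0. Qed.

Lemma Re_le_normc z : `|complex.Re z| <= Normc.normc z.
Proof.
rewrite -(@ler_pXn2r _ 2) ?nnegrE ?normc_ge0// real_normK ?num_real//.
by rewrite normc_sqrE lerDl sqr_ge0.
Qed.

Lemma Im_le_normc z : `|complex.Im z| <= Normc.normc z.
Proof.
rewrite -(@ler_pXn2r _ 2) ?nnegrE ?normc_ge0// real_normK ?num_real//.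
by rewrite normc_sqrE lerDr sqr_ge0.
Qed.

Lemma measurable_normc f : measurable_fun setT (fun x => complex.Re (f x)) ->
  measurable_fun setT (fun x => complex.Im (f x)) ->
  measurable_fun setT (fun x => Normc.normc (f x)).
Proof.
move=> mR mI.
have -> : (fun x => Normc.normc (f x)) =
    (fun x => (complex.Re (f x) ^+ 2 + complex.Im (f x) ^+ 2) `^ 2^-1).
  apply/funext => x; rewrite powR12_sqrt ?addr_ge0 ?sqr_ge0//.
  by case: (f x).
apply: (measurableT_comp (measurable_powR _)).
by apply: measurable_funD; exact: measurable_funX.
Qed.

Lemma cLnorm1E f : cLnorm 1 f = (\int[mu]_x (Normc.normc (f x))%:E)%E.
Proof.
rewrite /cLnorm Lnorm1; apply: eq_integral => x _ /=.
by rewrite ger0_norm// normc_ge0.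
Qed.

Lemma integrable_normc f : cLfun 1 f ->
  mu.-integrable setT (EFin \o (fun x => Normc.normc (f x))).
Proof.
move=> [mR mI fin]; apply/integrableP; split.
  by apply/measurable_EFinP; exact: measurable_normc.
rewrite cLnorm1E in fin; apply: le_lt_trans fin.
rewrite le_eqVlt; apply/orP; left; apply/eqP; apply: eq_integral => x _ /=.
by rewrite ger0_norm// normc_ge0.
Qed.

Lemma cLnorm1_fin f : cLfun 1 f ->
  cLnorm 1 f = (\int[mu]_x Normc.normc (f x))%:E.
Proof.
move=> Hf; rewrite cLnorm1E /Rintegral fineK//.
exact: (integrable_fin_num measurableT (integrable_normc Hf)).
Qed.

Lemma integrable_L11 f : L11 f ->
  mu.-integrable setT (EFin \o (fun x => (1 + normRn x) * Normc.normc (f x))).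
Proof.
move=> [[mR mI _] fin]; apply/integrableP; split.
  apply/measurable_EFinP; apply: measurable_funM; last exact: measurable_normc.
  by apply: measurable_funD => //; exact: measurable_normRn.
apply: le_lt_trans fin.
rewrite le_eqVlt; apply/orP; left; apply/eqP; apply: eq_integral => x _ /=.
by rewrite ger0_norm// mulr_ge0 ?normc_ge0// addr_ge0// normRn_ge0.
Qed.

Lemma L11norm_fin f : L11 f ->
  L11norm f = (\int[mu]_x ((1 + normRn x) * Normc.normc (f x)))%:E.
Proof.
move=> Hf; rewrite /L11norm /Rintegral fineK//.
exact: (integrable_fin_num measurableT (integrable_L11 Hf)).
Qed.

Lemma integrable_moment f : L11 f ->
  mu.-integrable setT (EFin \o (fun x => normRn x * Normc.normc (f x))).
Proof.
move=> Hf; have [[mR mI _] _] := Hf.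
apply: (le_integrable measurableT) (integrable_L11 Hf) => //.
  apply/measurable_EFinP; apply: measurable_funM; last exact: measurable_normc.
  exact: measurable_normRn.
move=> x _ /=; rewrite lee_fin !ger0_norm ?mulr_ge0 ?addr_ge0 ?normRn_ge0 ?normc_ge0//.
by rewrite ler_wpM2r ?normc_ge0// lerDr.
Qed.

Lemma fourierE f : cLfun 1 f -> fourier f = fourier_integral f.
Proof. by move=> Hf; rewrite /fourier; case: asboolP. Qed.

Lemma Re_fourier f xi : cLfun 1 f -> complex.Re (fourier f xi) =
  \int[mu]_x (cos (dotRn x xi) * complex.Re (f x) + sin (dotRn x xi) * complex.Im (f x)).
Proof.
move=> Hf; rewrite fourierE//= /Rintegral; congr fine; apply: eq_integral => x _ /=.
by case: (f x) => a b /=; congr EFin; ring.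
Qed.

Lemma Im_fourier f xi : cLfun 1 f -> complex.Im (fourier f xi) =
  \int[mu]_x (cos (dotRn x xi) * complex.Im (f x) + sin (dotRn x xi) * - complex.Re (f x)).
Proof.
move=> Hf; rewrite fourierE//= /Rintegral; congr fine; apply: eq_integral => x _ /=.
by case: (f x) => a b /=; congr EFin; ring.
Qed.

Variable p : R[i] -> R.
Hypothesis p_part : p = @complex.Re R \/ p = @complex.Im R.

(* [(g, h)] is [(Re f, Im f)] for the real part and [(Im f, - Re f)] for the
   imaginary part. *)
Lemma fourier_part f : cLfun 1 f -> exists g h : Rn R n -> R,
  [/\ measurable_fun setT g /\ measurable_fun setT h,
      forall x, `|g x| <= Normc.normc (f x),
      forall x, `|h x| <= Normc.normc (f x),
      forall xi, p (fourier f xi) =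
        \int[mu]_x (cos (dotRn x xi) * g x + sin (dotRn x xi) * h x) &
      p (cintegral f) = \int[mu]_x g x].
Proof.
move=> Hf; have [mR mI _] := Hf; case: p_part => ->.
  exists (fun x => complex.Re (f x)), (fun x => complex.Im (f x)); split => //.
  - by move=> x; exact: Re_le_normc.
  - by move=> x; exact: Im_le_normc.
  - by move=> xi; exact: Re_fourier.
exists (fun x => complex.Im (f x)), (fun x => - complex.Re (f x)); split => //.
- by split => //; exact: measurable_funN.
- by move=> x; exact: Im_le_normc.
- by move=> x; rewrite normrN; exact: Re_le_normc.
- by move=> xi; exact: Im_fourier.
Qed.

Lemma measurable_fourier_part f : cLfun 1 f ->
  measurable_fun setT (fun xi => p (fourier f xi)).
Proof.
move=> /fourier_part[g [h [[mg mh] _ _ E _]]].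
rewrite (_ : (fun xi => _) = fun xi => \int[mu]_x
  (cos (dotRn x xi) * g x + sin (dotRn x xi) * h x)); last exact/funext.
exact: measurable_osc_integral.
Qed.

Lemma fourier_part_le f xi : cLfun 1 f ->
  `|p (fourier f xi)| <= 2 * \int[mu]_x Normc.normc (f x).
Proof.
move=> Hf; have [g [h [[mg mh] gF hF -> _]]] := fourier_part Hf.
by apply: osc_integral_le => //; exact: integrable_normc.
Qed.

Lemma cintegral_part_le f : cLfun 1 f ->
  `|p (cintegral f)| <= \int[mu]_x Normc.normc (f x).
Proof.
move=> Hf; have [g [h [[mg mh] gF hF _ ->]]] := fourier_part Hf.
by apply: osc_integral0_le => //; exact: integrable_normc.
Qed.

Lemma fourier_partB_le f xi : L11 f ->
  `|p (fourier f xi) - p (cintegral f)| <=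
  normRn xi * (2 * \int[mu]_x ((1 + normRn x) * Normc.normc (f x))).
Proof.
move=> Hf; have [g [h [[mg mh] gF hF -> ->]]] := fourier_part (proj1 Hf).
apply: le_trans (osc_integralB_le mg mh gF hF (integrable_normc (proj1 Hf)) xi
  (integrable_moment Hf)) _.
rewrite ler_wpM2l ?normRn_ge0// ler_pM2l//; apply: le_Rintegral => //.
- exact: integrable_moment.
- exact: integrable_L11.
by move=> x _; rewrite ler_wpM2r ?normc_ge0// lerDr.
Qed.

Lemma norm1_le_L11 f : L11 f -> \int[mu]_x Normc.normc (f x) <=
  \int[mu]_x ((1 + normRn x) * Normc.normc (f x)).
Proof.
move=> Hf; apply: le_Rintegral => //.
- exact: integrable_normc (proj1 Hf).
- exact: integrable_L11.
by move=> x _; rewrite ler_peMl ?normc_ge0// lerDl normRn_ge0.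
Qed.

End fourier_bounds.

(** * Integration over the frequencies *)

(** The integral of a nonnegative function is a supremum over the simple functions below it, and
    those below [f] are below [g]. *)
Lemma ge0_le_integral_nomeas d (T : measurableType d) (R : realType)
    (mu : {measure set T -> \bar R}) (f g : T -> \bar R) :
  (forall x, 0 <= f x)%E -> (forall x, f x <= g x)%E ->
  (\int[mu]_x f x <= \int[mu]_x g x)%E.
Proof.
move=> f0 fg; have g0 x : (0 <= g x)%E by exact: le_trans (fg x).
rewrite !ge0_integralTE//; apply: le_ereal_sup => _ [h /= hf <-].
by exists h => // x; exact: le_trans (fg x).
Qed.

(* [f] may fail to be measurable: nothing of the sort is known of the
   representative [fourier (u t)]. *)
Lemma ge0_ae_le_integral d (T : measurableType d) (R : realType)
    (mu : {measure set T -> \bar R}) (f g : T -> \bar R) :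
  (forall x, 0 <= f x)%E -> (forall x, 0 <= g x)%E -> measurable_fun setT g ->
  {ae mu, forall x, f x <= g x}%E ->
  (\int[mu]_x f x <= \int[mu]_x g x)%E.
Proof.
move=> f0 g0 mg [N [mN N0 fgN]].
(* Raising [g] to infinity on the null set makes the inequality hold everywhere and leaves the
   integral unchanged. *)
pose g' x := if x \in N then +oo%E else g x.
have mg' : measurable_fun setT g'.
  apply: measurable_fun_ifT => //.
  apply: (@measurable_fun_bool _ _ _ _ true); rewrite setTI.
  rewrite [X in measurable X](_ : _ = N)//.
  by apply/seteqP; split => x /=; [move/set_mem|move=> Nx; exact: mem_set].
apply: (@le_trans _ _ (\int[mu]_x g' x)%E).
  apply: ge0_le_integral_nomeas => // x; rewrite /g'; case: ifPn => [_|]; first exact: leey.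
  by rewrite notin_setE => xN; apply: contrapT => h; apply: xN; exact: fgN.
rewrite (ge0_ae_eq_integral (f:=g') (g:=g))//.
- by move=> x _; rewrite /g'; case: ifP.
exists N; split => // x /=; rewrite /g'; apply: contra_notP => xN _.
by rewrite memNset.
Qed.

(** The sum of the constants of the low and high frequency bounds, so that one estimate covers both
    sides of r = 1. *)
Definition frequency_constant (R : realType) (l : R) : R :=
  8 * 16 ^+ 2 * expR 2^-1 + 4 * expR 1 + 8 * (3 * l) `^ l.

Lemma frequency_constant_gt0 (R : realType) (l : R) : 0 < frequency_constant l.
Proof.
rewrite /frequency_constant; have := powR_ge0 (3 * l) l.
have e1 : 0 < 8 * 16 ^+ 2 * expR 2^-1 :> R.
  by apply: mulr_gt0; [exact: mulr_gt0|exact: expR_gt0].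
have e2 : 0 < 4 * expR 1 :> R by apply: mulr_gt0; rewrite ?expR_gt0.
by move: (powR _ _) => z; lra.
Qed.

(** The three summands are nonnegative: the first one bounds the error for r <= 1, the other two for
    r >= 1. *)
Lemma damped_osc_profile (R : realType) (l r t a b m0 m1 n0 n1 p0 p1 : R) y dy :
  damped_osc r a b y dy -> 1 <= l -> 0 < r -> 1 <= t ->
  `|a - p0| <= r * m0 -> `|a| <= m0 -> `|p0| <= n0 ->
  `|b - p1| <= r * m1 -> `|b| <= m1 -> `|p1| <= n1 ->
  (y t - profile r t p0 p1) ^+ 2 <= frequency_constant l *
   (expR (- (Num.sqrt t * r ^+ 2)) * (m1 ^+ 2 + m0 ^+ 2 / Num.sqrt t)
    + expR (- t) * expR (- r ^+ 2) * (n1 ^+ 2 + n0 ^+ 2)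
    + t `^ (- l) * (r `^ (2 * (l - 1)) * b ^+ 2 + r `^ (2 * l) * a ^+ 2)).
Proof.
move=> H l1 r0 t1 hp0 ha hn0 hp1 hb hn1.
have t0 : 0 < t by exact: lt_le_trans t1.
rewrite /frequency_constant.
set K1 := 8 * 16 ^+ 2 * _; set K2 := 4 * _; set K3 := 8 * _.
have K10 : 0 <= K1 by apply: mulr_ge0; [exact: mulr_ge0|exact: expR_ge0].
have K20 : 0 <= K2 by apply: mulr_ge0; rewrite ?expR_ge0.
have K30 : 0 <= K3 by apply: mulr_ge0; rewrite ?powR_ge0.
set X := expR (- (Num.sqrt t * r ^+ 2)) * _.
set Y := _ * (n1 ^+ 2 + n0 ^+ 2); set Z := t `^ (- l) * _.
have X0 : 0 <= X.
  by apply: mulr_ge0; rewrite ?expR_ge0// addr_ge0 ?divr_ge0 ?sqr_ge0.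
have Y0 : 0 <= Y.
  apply: mulr_ge0; last by rewrite addr_ge0 ?sqr_ge0.
  by apply: mulr_ge0; exact: expR_ge0.
have Z0 : 0 <= Z.
  by apply: mulr_ge0; rewrite ?powR_ge0// addr_ge0// mulr_ge0 ?powR_ge0 ?sqr_ge0.
have Y0' : 0 <= expR (- t) * expR (- r ^+ 2) * (p1 ^+ 2 + p0 ^+ 2).
  apply: mulr_ge0; last by rewrite addr_ge0 ?sqr_ge0.
  by apply: mulr_ge0; exact: expR_ge0.
have [r1|/ltW r1] := leP r 1.
  have r01 : 0 < r <= 1 by rewrite r0.
  have := low_frequency H r01 t0 hp0 ha hp1 hb; rewrite -mulrA -/K1 -/X => h.
  apply: le_trans h _; rewrite -subr_ge0.
  rewrite (_ : _ - _ = K1 * (Y + Z) + (K2 + K3) * (X + Y + Z)); last by ring.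
  by rewrite addr_ge0 ?mulr_ge0 ?addr_ge0.
have := @high_frequency _ l r t a b p0 p1 y dy H l1 r1 t1.
rewrite -/K2 -/K3 -/Z; set Y' := expR (- t) * _ * _ => h.
have YY : Y' <= Y.
  apply: ler_wpM2l; first by apply: mulr_ge0; exact: expR_ge0.
  have sq (u v : R) : `|u| <= v -> u ^+ 2 <= v ^+ 2.
    by move=> uv; rewrite -(real_normK (num_real u)) lerXn2r// nnegrE (le_trans _ uv).
  by apply: lerD; exact: sq.
apply: le_trans h _; rewrite -subr_ge0.
rewrite (_ : _ - _ = K1 * (X + Y + Z) + K2 * (X + (Y - Y') + Z) + K3 * (X + Y)); last by ring.
have d0 : 0 <= Y - Y' by rewrite subr_ge0.
have q1 : 0 <= X + Y + Z by rewrite !addr_ge0.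
have q2 : 0 <= X + (Y - Y') + Z by apply: addr_ge0 => //; exact: addr_ge0.
have q3 : 0 <= X + Y by rewrite addr_ge0.
by apply: addr_ge0; [apply: addr_ge0|]; apply: mulr_ge0.
Qed.

(** The Gaussian integral over R^n at a = sqrt t, which is where the exponent n / 4 comes from. *)
Lemma gaussian_rate (R : realType) (n : nat) (t : R) : 0 < t ->
  Num.sqrt (pi / Num.sqrt t) ^+ n = Num.sqrt pi ^+ n * t `^ (- (n%:R / 4)).
Proof.
move=> t0; have s0 := sqrtr_ge0 t.
rewrite sqrtrM ?pi_ge0// exprMn; congr (_ * _).
rewrite -powR_mulrn ?sqrtr_ge0// -powR12_sqrt ?invr_ge0// -(powR_inv1 s0).
by rewrite -powR12_sqrt ?(ltW t0)// -!powRrM; congr (_ `^ _); field.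
Qed.

Lemma powRN_sqrt (R : realType) (n : nat) (t : R) : 0 < t ->
  t `^ (- ((n%:R + 2) / 4)) = t `^ (- (n%:R / 4)) / Num.sqrt t.
Proof.
move=> t0; rewrite -powR12_sqrt ?(ltW t0)// -powRN -powRD; last first.
  by rewrite (gt_eqF t0) implybT.
by congr (_ `^ _); field.
Qed.

Lemma sqr_Dnorm (R : realType) n (s : R) (f : Rn R n -> R[i]) :
  (Dnorm s f ^+ 2 = \int[@lebesgue_Rn R n]_xi
    (normRn xi `^ (2 * s) * Normc.normc (fourier f xi) ^+ 2)%:E)%E.
Proof.
by rewrite /Dnorm poweR12_sqrt ?sqr_sqrte// integral_ge0// => x _;
  rewrite lee_fin mulr_ge0 ?powR_ge0 ?sqr_ge0.
Qed.

Lemma measurable_weight (R : realType) n (s : R) (f : Rn R n -> R[i]) :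
  cLfun 1 f -> measurable_fun setT
    (fun xi => normRn xi `^ s * Normc.normc (fourier f xi) ^+ 2).
Proof.
move=> Hf; apply: measurable_funM.
  exact: (measurableT_comp (measurable_powR _) (@measurable_normRn R n)).
apply: measurable_funX; apply: measurable_normc.
  by apply: measurable_fourier_part => //; left.
by apply: measurable_fourier_part => //; right.
Qed.

(** The real estimate is applied to the real and imaginary parts and the two are added. As each part
    of a transform is at most twice the [L11norm], the first constant is 2 times 2^2 = 8; the parts
    of P_j are at most the L^1 norm, which leaves 2 in the second. *)
Lemma ae_profile_error (R : realType) n (l t : R) (u0 u1 : Rn R n -> R[i])
    (u : R -> Rn R n -> R[i]) :
  (0 < n)%N -> 1 <= l -> 1 <= t -> L11 u0 -> L11 u1 -> mild_solution u0 u1 u ->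
  {ae @lebesgue_Rn R n, forall xi,
    Normc.normc (fourier (u t) xi
      - (cintegral u1
         * real_complex R (expR (- (t * normRn xi ^+ 4 / 2))
                           * (sin (t * normRn xi) / normRn xi))
         + cintegral u0
         * real_complex R (expR (- (t * normRn xi ^+ 4 / 2))
                           * cos (t * normRn xi)))) ^+ 2 <=
    frequency_constant l *
     (8 * (expR (- (Num.sqrt t * normRn xi ^+ 2)) *
        (fine (L11norm u1) ^+ 2 + fine (L11norm u0) ^+ 2 / Num.sqrt t))
      + 2 * (expR (- t) * expR (- normRn xi ^+ 2) *
        (fine (cLnorm 1 u1) ^+ 2 + fine (cLnorm 1 u0) ^+ 2))
      + t `^ (- l) *
        (normRn xi `^ (2 * (l - 1)) * Normc.normc (fourier u1 xi) ^+ 2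
         + normRn xi `^ (2 * l) * Normc.normc (fourier u0 xi) ^+ 2))}.
Proof.
move=> n0 l1 t1 H0 H1 Hu; have t0 : 0 <= t by exact: le_trans t1.
have [w [wE ode]] := mild_fourier Hu.
have := ae_normRn_gt0 (R := R) n0; have := wE t t0; move: ode.
(* Three null sets are discarded: where the equation fails, where [w t] differs from the transform
   of [u t], and the origin. *)
apply: filterS3 => xi ode <- r0.
rewrite !L11norm_fin// (cLnorm1_fin (proj1 H0)) (cLnorm1_fin (proj1 H1)) /=.
set r := normRn xi in r0 ode *.
set M0 := (X in 8 * (_ * (_ + X ^+ 2 / _))).
set M1 := (X in 8 * (_ * (X ^+ 2 + _))).
set N0 := (X in 2 * (_ * (_ + X ^+ 2))).
set N1 := (X in 2 * (_ * (X ^+ 2 + _))).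
set z := (X in Normc.normc X).
have bound (p : R[i] -> R) : p = @complex.Re R \/ p = @complex.Im R ->
    {morph p : z w / z + w} -> (forall (x : R) z, p (real_complex R x * z) = x * p z) ->
    (forall z, `|p z| <= Normc.normc z) ->
    p z ^+ 2 <=
    frequency_constant l *
     (expR (- (Num.sqrt t * r ^+ 2)) * ((2 * M1) ^+ 2 + (2 * M0) ^+ 2 / Num.sqrt t)
      + expR (- t) * expR (- r ^+ 2) * (N1 ^+ 2 + N0 ^+ 2)
      + t `^ (- l) * (r `^ (2 * (l - 1)) * p (fourier u1 xi) ^+ 2
         + r `^ (2 * l) * p (fourier u0 xi) ^+ 2)).
  move=> pp pD pZ ple.
  have [dy Hosc] := damped_osc_of_fourier_ode pD pZ ple ode.
  have le2 f : L11 f -> `|p (fourier f xi)| <=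
      2 * \int[@lebesgue_Rn R n]_x ((1 + normRn x) * Normc.normc (f x)).
    move=> Hf; apply: le_trans (fourier_part_le pp xi (proj1 Hf)) _.
    by rewrite ler_pM2l// norm1_le_L11.
  have -> : p z = p (w t xi) - profile r t (p (cintegral u0)) (p (cintegral u1)).
    have pN x : p (- x) = - p x.
      by rewrite -mulN1r -[- 1](_ : real_complex R (-1) = _) ?pZ ?mulN1r// rmorphN rmorph1.
    rewrite /z pD pN pD /profile; congr (_ - (_ + _)).
      by rewrite mulrC pZ mulrC.
    by rewrite mulrC pZ mulrC.
  apply: (damped_osc_profile Hosc) => //.
  - exact: fourier_partB_le.
  - exact: le2.
  - exact: (cintegral_part_le pp (proj1 H0)).
  - exact: fourier_partB_le.
  - exact: le2.
  - exact: (cintegral_part_le pp (proj1 H1)).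
have ReD : {morph @complex.Re R : z w / z + w} by move=> [a b] [c d].
have ImD : {morph @complex.Im R : z w / z + w} by move=> [a b] [c d].
have ReZ (x : R) v : complex.Re (real_complex R x * v) = x * complex.Re v.
  by case: v => a b /=; rewrite mul0r subr0.
have ImZ (x : R) v : complex.Im (real_complex R x * v) = x * complex.Im v.
  by case: v => a b /=; rewrite mul0r addr0.
have hRe := bound _ (or_introl erefl) ReD ReZ (@Re_le_normc R).
have hIm := bound _ (or_intror erefl) ImD ImZ (@Im_le_normc R).
rewrite !normc_sqrE; apply: le_trans (lerD hRe hIm) _.
rewrite -mulrDr ler_pM2l ?frequency_constant_gt0//.
by rewrite le_eqVlt; apply/orP; left; apply/eqP; ring.
Qed.

(** To be read with Q = pi^{n/2}, g = t^{- n/4}, s = t^{- 1/2}, e = e^{- t} and z = t^{- l}. The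
    constant K (8 Q + 1) dominates 8 K Q, 2 K Q and K. The [D] and [E] terms are extended reals,
    assumed only nonnegative. *)
Lemma assemble_bounds (R : realType) (K Q g s e z M0 M1 N0 N1 : R)
    (D0 D1 E0 E1 : \bar R) :
  0 <= K -> 0 <= Q -> 0 <= g -> 0 <= s -> 0 <= e -> 0 <= z ->
  (0 <= D0 -> 0 <= D1 -> 0 <= E0 -> 0 <= E1 ->
   (K * 8 * (M1 ^+ 2 + M0 ^+ 2 * s))%:E * (Q * g)%:E
   + (K * 2 * e * (N1 ^+ 2 + N0 ^+ 2))%:E * Q%:E
   + (K * z)%:E * D1 + (K * z)%:E * D0 <=
   (K * (8 * Q + 1))%:E * M1%:E ^+ 2 * g%:E
   + (K * (8 * Q + 1))%:E * M0%:E ^+ 2 * (g * s)%:E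
   + (K * (8 * Q + 1))%:E * e%:E * (N1%:E ^+ 2 + N0%:E ^+ 2 + E1 + E0)
   + (K * (8 * Q + 1))%:E * z%:E * (D1 + D0))%E.
Proof.
move=> K0 Q0 g0 s0 e0 z0 D00 D10 E00 E10.
set C := K * (8 * Q + 1).
have C0 : 0 <= C by apply: mulr_ge0 => //; lra.
have KC : K <= C by rewrite /C ler_peMr//; lra.
rewrite -[leLHS]addeA; apply: leeD; last first.
  rewrite -ge0_muleDr//; apply: lee_wpmul2r; first exact: adde_ge0.
  by rewrite -EFinM lee_fin ler_wpM2r.
apply: leeD.
  rewrite -!EFin_expe -!EFinM -EFinD lee_fin -subr_ge0.
  have -> : C * M1 ^+ 2 * g + C * M0 ^+ 2 * (g * s) -
    K * 8 * (M1 ^+ 2 + M0 ^+ 2 * s) * (Q * g) = K * g * (M1 ^+ 2 + M0 ^+ 2 * s).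
    by rewrite /C; ring.
  apply: mulr_ge0; first exact: mulr_ge0.
  by rewrite addr_ge0 ?sqr_ge0// mulr_ge0 ?sqr_ge0.
apply: (@le_trans _ _ ((C * e)%:E * (N1 ^+ 2 + N0 ^+ 2)%:E)%E).
  rewrite -!EFinM lee_fin -subr_ge0.
  have -> : C * e * (N1 ^+ 2 + N0 ^+ 2) - K * 2 * e * (N1 ^+ 2 + N0 ^+ 2) * Q =
    K * e * (N1 ^+ 2 + N0 ^+ 2) * (6 * Q + 1) by rewrite /C; ring.
  apply: mulr_ge0; last by lra.
  by apply: mulr_ge0; [exact: mulr_ge0|rewrite addr_ge0 ?sqr_ge0].
rewrite -(EFinM C e); apply: lee_wpmul2l; first by rewrite lee_fin mulr_ge0.
by rewrite -!EFin_expe -EFinD -addeA leeDl// adde_ge0.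
Qed.

Theorem theorem1p3 (R : realType) (n : nat) (l : R)
    (hn : (1 <= n)%N)
    (hl6 : (6 <= n)%N -> n%:R / 4 - 1 / 2 < l)
    (hl5 : (n <= 5)%N -> 1 <= l) :
  exists C alpha T : R, [/\ 0 < C, 0 < alpha, 0 < T &
    forall (u0 u1 : Rn R n -> R[i]) (u : R -> Rn R n -> R[i]),
      Hs l u0 -> L11 u0 -> Hs (l - 1) u1 -> L11 u1 ->
      mild_solution u0 u1 u ->
      forall t : R, T <= t ->
        (\int[@lebesgue_Rn R n]_xi
           (Normc.normc
              (fourier (u t) xi
               - (cintegral u1
                  * real_complex R (expR (- (t * normRn xi ^+ 4 / 2))
                                    * (sin (t * normRn xi) / normRn xi))
                  + cintegral u0
                  * real_complex R (expR (- (t * normRn xi ^+ 4 / 2))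
                                    * cos (t * normRn xi)))) ^+ 2)%:E
         <= C%:E * L11norm u1 ^+ 2 * (t `^ (- (n%:R / 4)))%:E
          + C%:E * L11norm u0 ^+ 2 * (t `^ (- ((n%:R + 2) / 4)))%:E
          + C%:E * (expR (- (alpha * t)))%:E
            * (cLnorm 1 u1 ^+ 2 + cLnorm 1 u0 ^+ 2
               + cLnorm 2%:E u1 ^+ 2 + cLnorm 2%:E u0 ^+ 2)
          + C%:E * (t `^ (- l))%:E
            * (Dnorm (l - 1) u1 ^+ 2 + Dnorm l u0 ^+ 2))%E].
Proof.
have n0 : (0 < n)%N by [].
(* For n >= 6 the threshold n / 4 - 1 / 2 is already at least 1. *)
have l1 : 1 <= l.
  have [/hl5//|n6] := leqP n 5.
  apply/ltW/(le_lt_trans _ (hl6 n6)).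
  have : 6%:R <= n%:R :> R by rewrite ler_nat.
  by lra.
set K := frequency_constant l; have K0 : 0 < K by exact: frequency_constant_gt0.
set Q := Num.sqrt (pi : R) ^+ n; have Q0 : 0 <= Q by rewrite exprn_ge0.
(* The rate [alpha] = 1 and the time [T] = 1 come from the high frequency bound on the profile,
   where t >= 1 gives the factor e^{- t}. *)
exists (K * (8 * Q + 1)), 1, 1; split => //.
  by rewrite mulr_gt0//; lra.
move=> u0 u1 u hs0 H0 hs1 H1 Hu t t1.
have t0 : 0 < t by exact: lt_le_trans t1.
have [c0 c1] : cLfun 1 u0 /\ cLfun 1 u1 by split; [exact: proj1 H0|exact: proj1 H1].
set mu := @lebesgue_Rn R n.
pose M0 := fine (L11norm u0); pose M1 := fine (L11norm u1).
pose N0 := fine (cLnorm 1 u0); pose N1 := fine (cLnorm 1 u1).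
have s0 := sqrtr_ge0 t.
pose G1 (xi : Rn R n) := (expR (- (Num.sqrt t * normRn xi ^+ 2)))%:E.
pose G2 (xi : Rn R n) := (expR (- (1 * normRn xi ^+ 2)))%:E.
pose W1 (xi : Rn R n) := (normRn xi `^ (2 * (l - 1)) * Normc.normc (fourier u1 xi) ^+ 2)%:E.
pose W0 (xi : Rn R n) := (normRn xi `^ (2 * l) * Normc.normc (fourier u0 xi) ^+ 2)%:E.
pose k1 := K * 8 * (M1 ^+ 2 + M0 ^+ 2 * (Num.sqrt t)^-1).
pose k2 := K * 2 * expR (- (1 * t)) * (N1 ^+ 2 + N0 ^+ 2).
pose k3 := K * t `^ (- l).
have k10 : 0 <= k1.
  apply: mulr_ge0; first by apply: mulr_ge0 => //; exact: ltW.
  by rewrite addr_ge0 ?sqr_ge0// mulr_ge0 ?sqr_ge0 ?invr_ge0.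
have k20 : 0 <= k2.
  apply: mulr_ge0; last by rewrite addr_ge0 ?sqr_ge0.
  by apply: mulr_ge0; [apply: mulr_ge0 => //; exact: ltW|exact: expR_ge0].
have k30 : 0 <= k3 by apply: mulr_ge0; [exact: ltW|exact: powR_ge0].
have mG a : measurable_fun setT (fun xi : Rn R n => (expR (- (a * normRn xi ^+ 2)))%:E).
  apply/measurable_EFinP; apply: measurableT_comp => //.
  apply: measurableT_comp => //; apply: measurable_funM => //.
  by apply: measurable_funX; exact: measurable_normRn.
have mG1 : measurable_fun setT G1 by exact: mG.
have mG2 : measurable_fun setT G2 by exact: mG.
(* The data are in L^1, so their transforms are given by integrals and are measurable in xi. *)
have mW1 : measurable_fun setT W1 by apply/measurable_EFinP; exact: measurable_weight.
have mW0 : measurable_fun setT W0 by apply/measurable_EFinP; exact: measurable_weight.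
have G10 xi : (0 <= G1 xi)%E by rewrite lee_fin expR_ge0.
have G20 xi : (0 <= G2 xi)%E by rewrite lee_fin expR_ge0.
have W10 xi : (0 <= W1 xi)%E by rewrite lee_fin mulr_ge0 ?powR_ge0 ?sqr_ge0.
have W00 xi : (0 <= W0 xi)%E by rewrite lee_fin mulr_ge0 ?powR_ge0 ?sqr_ge0.
have mZ (k : R) f : measurable_fun setT f ->
    measurable_fun setT (fun xi : Rn R n => (k%:E * f xi)%E).
  by move=> mf; exact: measurable_funeM.
have m12 : measurable_fun setT (fun xi => k1%:E * G1 xi + k2%:E * G2 xi)%E.
  by apply: emeasurable_funD; exact: mZ.
have m123 : measurable_fun setT (fun xi => k1%:E * G1 xi + k2%:E * G2 xi + k3%:E * W1 xi)%E.
  by apply: emeasurable_funD => //; exact: mZ.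
have Z0 (k : R) (x : \bar R) : 0 <= k -> (0 <= x)%E -> (0 <= k%:E * x)%E.
  by move=> ? ?; apply: mule_ge0.
apply: (@le_trans _ _ (\int[mu]_xi
    (k1%:E * G1 xi + k2%:E * G2 xi + k3%:E * W1 xi + k3%:E * W0 xi))%E).
  apply: ge0_ae_le_integral.
  - by move=> xi; rewrite lee_fin sqr_ge0.
  - by move=> xi; rewrite !adde_ge0// Z0.
  - by apply: emeasurable_funD => //; exact: mZ.
  have := ae_profile_error n0 l1 t1 H0 H1 Hu; apply: filterS => xi h.
  rewrite -!EFinM -!EFinD lee_fin; apply: le_trans h _.
  rewrite le_eqVlt; apply/orP; left; apply/eqP.
  by rewrite /k1 /k2 /k3 !mul1r -/K -/M0 -/M1 -/N0 -/N1; ring.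
rewrite ge0_integralD//; last 3 first.
- by move=> xi _; rewrite !adde_ge0// Z0.
- by move=> xi _; rewrite Z0.
- exact: mZ.
rewrite ge0_integralD//; last 3 first.
- by move=> xi _; rewrite !adde_ge0// Z0.
- by move=> xi _; rewrite Z0.
- exact: mZ.
rewrite ge0_integralD//; last 4 first.
- by move=> xi _; rewrite Z0.
- exact: mZ.
- by move=> xi _; rewrite Z0.
- exact: mZ.
rewrite !ge0_integralZl//.
(* The width parameter sqrt t produces the rate; the second Gaussian has parameter 1 and contributes
   only the constant [Q]. *)
have -> : (\int[mu]_xi G1 xi = (Q * t `^ (- (n%:R / 4)))%:E)%E.
  by rewrite integral_gaussian_Rn ?sqrtr_gt0// gaussian_rate.
have -> : (\int[mu]_xi G2 xi = Q%:E)%E by rewrite integral_gaussian_Rn// divr1.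
rewrite powRN_sqrt// -!sqr_Dnorm.
have -> : L11norm u1 = M1%:E by rewrite /M1 L11norm_fin.
have -> : L11norm u0 = M0%:E by rewrite /M0 L11norm_fin.
have -> : cLnorm 1 u1 = N1%:E by rewrite /N1 cLnorm1_fin.
have -> : cLnorm 1 u0 = N0%:E by rewrite /N0 cLnorm1_fin.
have sq0 (x : \bar R) : (0 <= x -> 0 <= x ^+ 2)%E by move=> x0; rewrite expe_ge0.
apply: assemble_bounds; rewrite ?powR_ge0 ?expR_ge0 ?invr_ge0 ?(ltW K0)//.
- exact/sq0/poweR_ge0.
- exact/sq0/poweR_ge0.
- exact/sq0/Lnorm_ge0.
- exact/sq0/Lnorm_ge0.
Qed.
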